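(* Let $T$ be a maximal torus of $SL_n(\mathbb{C})$ and let $G_{r,n}$ be the Grassmannian of $r$-dimensional subspaces of $\mathbb{C}^n$. The GIT quotient $T\backslash\backslash(G_{r,n})^{ss}_T(\mathcal{L}_{n\varpi_r})$ is projectively normal with respect to the descent of $\mathcal{L}_{n\varpi_r}$ if $r=1,2,n-2,n-1$.
   Context: All varieties are over $\mathbb{C}$. $G_{r,n}=SL_n/P_{\alpha_r}$, where $P_{\alpha_r}$ is the maximal parabolic subgroup associated to the simple root $\alpha_r$, and $\varpi_r$ is the corresponding fundamental weight. $\mathcal{L}_{\varpi_r}$ is the Plücker line bundle (the restriction of $\mathcal{O}(1)$ under $G_{r,n}\subset\mathbb{P}(\wedge^r\mathbb{C}^n)$) with the linearization coming from the natural action of $SL_n$ on $\wedge^r\mathbb{C}^n$, restricted to $T$; $\mathcal{L}_{n\varpi_r}=\mathcal{L}_{\varpi_r}^{\otimes n}$. GIT quotient: for a projective variety $X$ with an action of $T$ and a $T$-linearized very ample line bundle $\mathcal{L}$, $X^{ss}_T(\mathcal{L})$ is the open set of semistable points and $T\backslash\backslash X^{ss}_T(\mathcal{L})$ is its uniform categorical quotient by $T$. $\mathcal{L}$ descends to the quotient if there is a line bundle $\mathcal{L}'$ on the quotient whose pullback to $X^{ss}_T(\mathcal{L})$ is $T$-equivariantly isomorphic to $\mathcal{L}|_{X^{ss}_T(\mathcal{L})}$; $\mathcal{L}'$ is called the descent of $\mathcal{L}$. Then the polarized variety $(T\backslash\backslash X^{ss}_T(\mathcal{L}),\mathcal{L}')$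 is $\mathrm{Proj}\big(\bigoplus_{k\ge0}H^0(X,\mathcal{L}^{\otimes k})^T\big)$, and its homogeneous coordinate ring is $\bigoplus_{k\ge 0}H^0(X,\mathcal{L}^{\otimes k})^T$, graded by $k$. Since $n\varpi_r$ lies in the root lattice, $\mathcal{L}_{n\varpi_r}$ is known to descend. Projective normality: a polarized variety $(Y,\mathcal{M})$ ($\mathcal{M}$ a very ample line bundle) is projectively normal if its homogeneous coordinate ring $\bigoplus_{k\ge0}H^0(Y,\mathcal{M}^{\otimes k})$ is integrally closed and is generated as a $\mathbb{C}$-algebra by its degree one part $H^0(Y,\mathcal{M})$. *)

(* Defs.v *)
From HB Require Import structures.
From mathcomp Require Import all_boot all_order all_algebra.
From mathcomp Require Import boolp classical_sets functions reals.
From mathcomp.real_closed Require Import complex.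
From mathcomp Require Import mpoly.

Set Implicit Arguments.
Unset Strict Implicit.
Unset Printing Implicit Defensive.

Import GRing.Theory.
Local Open Scope ring_scope.
Local Open Scope classical_set_scope.

Section Torus.
Context {C : closedFieldType}.

Definition SL (n : nat) : set 'M[C]_n := [set g | \det g = 1].

Arguments SL n _ : clear implicits.

Definition Zariski_closed (n : nat) (Z : set 'M[C]_n) : Prop :=
  exists P : set {mpoly C[n * n]},
    Z = [set g | forall p, P p -> p.@[fun k => mxvec g 0 k] = 0].

(* The points of the algebraic group (G_m)^d. *)
Definition Gm (d : nat) : set ('I_d -> C) := [set t | forall i, t i != 0].
Arguments Gm d _ : clear implicits.

(* A closed subgroup of SL_n isomorphic, as an algebraic group, to some
   (G_m)^d: regular functions on (G_m)^d are the p / (t_1 ... t_d)^k with p a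
   polynomial, and regular functions on the closed set H are the restrictions
   of polynomials in the matrix entries. *)
Definition is_torus (n : nat) (H : set 'M[C]_n) : Prop :=
  [/\ H `<=` SL n,
      Zariski_closed H
    & exists d (phi : ('I_d -> C) -> 'M[C]_n),
      [/\ H = phi @` Gm d,
          {in Gm d &, forall t u,
             phi (fun l => t l * u l) = phi t *m phi u},
          forall i j, exists (p : {mpoly C[d]}) (k : nat),
            {in Gm d, forall t, phi t i j = p.@[t] / (\prod_l t l) ^+ k}
        & forall l, exists q : {mpoly C[n * n]},
            {in Gm d, forall t, q.@[fun k => mxvec (phi t) 0 k] = t l}]].

Definition maximal_torus (n : nat) (T : set 'M[C]_n) : Prop :=
  is_torus T /\ forall H, is_torus H -> T `<=` H -> H = T.

End Torus.

Section Cone.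
Context {C : closedFieldType}.

(* A projective variety X in P^(N-1) is handled through its punctured affine
   cone: the set of nonzero vectors of C^N representing a point of X. *)
Record cone (N : nat) := Cone {
  cone_set :> set 'cV[C]_N;
  cone_pt : 'cV[C]_N;
  cone_ptP : cone_pt \in cone_set }.

Definition cpoint (N : nat) (X : cone N) : Type := {v | v \in cone_set X}.
HB.instance Definition _ N (X : cone N) := Choice.on (cpoint X).
HB.instance Definition _ N (X : cone N) :=
  isPointed.Build (cpoint X) (exist _ (cone_pt X) (cone_ptP X)).

Definition pev (N : nat) (X : cone N) (p : {mpoly C[N]}) (x : cpoint X) : C :=
  p.@[fun i => val x i 0].

(* H^0(X, O(m)): a section of O(m) over X is a function s on the punctured
   cone that is, in a Zariski neighbourhood of every point, a quotient p / q
   of forms with deg p - deg q = m; in particular s (c v) = c ^ m s v. *)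
Definition is_section (N : nat) (X : cone N) (m : nat) (s : cpoint X -> C) :
    Prop :=
  forall x : cpoint X, exists (d : nat) (p q : {mpoly C[N]}),
    [/\ p \is (d + m).-homog, q \is d.-homog, pev q x != 0
      & forall y : cpoint X, pev q y != 0 -> s y = pev p y / pev q y].

(* H^0(X, O(m))^H, where O(m) carries the linearization given by the matrices
   in H acting on C^N. *)
Definition is_invariant_section (N : nat) (X : cone N) (H : set 'M[C]_N)
    (m : nat) (s : cpoint X -> C) : Prop :=
  is_section m s /\
  forall h, H h -> forall x y : cpoint X, val y = h *m val x -> s y = s x.

(* The graded ring (+)_k H^0(X, L^k)^H for L = O(d), that is, the homogeneous
   coordinate ring of the GIT quotient H \\ X^ss(L) polarized by the descent of
   L. The family (s_k)_k is encoded as the polynomial \sum_k s_k 'X^k over the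
   ring of all functions on the punctured cone. *)
Definition git_ring_pred (N : nat) (X : cone N) (H : set 'M[C]_N) (d : nat) :
    {pred {poly (cpoint X -> C)}} :=
  fun P => `[< forall k, is_invariant_section H (d * k) (P`_k) >].

Lemma invariant_section0 N (X : cone N) H m :
  is_invariant_section H m (0 : cpoint X -> C).
Proof.
split=> // x; exists 0%N, 0, 1; split.
- exact: dhomog0.
- exact: dhomog1.
- by rewrite /pev meval1 oner_eq0.
- by move=> y _; rewrite /pev meval0 mul0r.
Qed.

Lemma invariant_section1 N (X : cone N) H :
  is_invariant_section H 0 (1 : cpoint X -> C).
Proof.
split=> // x; exists 0%N, 1, 1; split.
- exact: dhomog1.
- exact: dhomog1.
- by rewrite /pev meval1 oner_eq0.
- by move=> y _; rewrite /pev meval1 divr1.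
Qed.

Lemma invariant_sectionB N (X : cone N) H m (s t : cpoint X -> C) :
  is_invariant_section H m s -> is_invariant_section H m t ->
  is_invariant_section H m (s - t).
Proof.
move=> [s1 s2] [t1 t2]; split; last first.
  by move=> h Hh x y e; rewrite !fctE (s2 h Hh x y e) (t2 h Hh x y e).
move=> x; have [d [p [q [hp hq qx eq]]]] := s1 x.
have [d' [p' [q' [hp' hq' qx' eq']]]] := t1 x.
exists (d + d')%N, (p * q' - p' * q), (q * q').
have pevM a b z : @pev N X (a * b) z = pev a z * pev b z by rewrite /pev mevalM.
split.
- apply: rpredB; first by rewrite addnAC; exact: dhomogM.
  by rewrite -addnA addnC; exact: dhomogM.
- exact: dhomogM.
- by rewrite pevM mulf_neq0.
- move=> y; rewrite pevM mulf_eq0 negb_or => /andP[qy qy'].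
  rewrite !fctE (eq y qy) (eq' y qy') /pev mevalB -!/(pev _ _) !pevM.
  by rewrite -mulNr addf_div // mulNr.
Qed.

Lemma invariant_sectionM N (X : cone N) H m m' (s t : cpoint X -> C) :
  is_invariant_section H m s -> is_invariant_section H m' t ->
  is_invariant_section H (m + m') (s * t).
Proof.
move=> [s1 s2] [t1 t2]; split; last first.
  by move=> h Hh x y e; rewrite !fctE (s2 h Hh x y e) (t2 h Hh x y e).
move=> x; have [d [p [q [hp hq qx eq]]]] := s1 x.
have [d' [p' [q' [hp' hq' qx' eq']]]] := t1 x.
exists (d + d')%N, (p * p'), (q * q').
have pevM a b z : @pev N X (a * b) z = pev a z * pev b z by rewrite /pev mevalM.
split.
- by rewrite addnACA; exact: dhomogM.
- exact: dhomogM.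
- by rewrite pevM mulf_neq0.
- move=> y; rewrite pevM mulf_eq0 negb_or => /andP[qy qy'].
  by rewrite !fctE (eq y qy) (eq' y qy') !pevM mulf_div.
Qed.

Lemma git_ring_closed N (X : cone N) H d : subring_closed (@git_ring_pred N X H d).
Proof.
split.
- apply/asboolP => k; rewrite coef1; case: k => [|k] /=.
    by rewrite muln0; exact: invariant_section1.
  exact: invariant_section0.
- move=> P Q /asboolP hP /asboolP hQ; apply/asboolP => k; rewrite coefB.
  exact: invariant_sectionB.
- move=> P Q /asboolP hP /asboolP hQ; apply/asboolP => k; rewrite coefM.
  elim/big_ind: _ => [|s t hs ht|i _]; first exact: invariant_section0.
    rewrite -[t]opprK -[- t]sub0r; apply: invariant_sectionB => //.
    by apply: invariant_sectionB => //; exact: invariant_section0.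
  have -> : (d * k = d * i + d * (k - i))%N.
    by rewrite -mulnDr subnKC // -ltnS ltn_ord.
  exact: invariant_sectionM.
Qed.

HB.instance Definition _ N (X : cone N) H d :=
  GRing.isSubringClosed.Build {poly (cpoint X -> C)} (@git_ring_pred N X H d)
    (@git_ring_closed N X H d).

Record git_ring (N : nat) (X : cone N) (H : set 'M[C]_N) (d : nat) := GitRing {
  git_poly :> {poly (cpoint X -> C)};
  git_polyP : git_poly \in git_ring_pred H d }.

HB.instance Definition _ N (X : cone N) H d :=
  [isSub for @git_poly N X H d].
HB.instance Definition _ N (X : cone N) H d :=
  [Choice of git_ring X H d by <:].
HB.instance Definition _ N (X : cone N) H d :=
  [SubChoice_isSubComNzRing of git_ring X H d by <:].

(* A is a domain and is integrally closed in its field of fractions. *)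
Definition integrally_closed (A : comNzRingType) : Prop :=
  (forall a b : A, a * b = 0 -> a = 0 \/ b = 0) /\
  forall (K : fieldType) (f : {rmorphism A -> K}),
    injective f ->
    (forall z : K, exists a b : A, b != 0 /\ z = f a / f b) ->
    forall z : K, integralOver f z -> exists a : A, z = f a.

Definition git_homogeneous N (X : cone N) H d (k : nat) (a : git_ring X H d) :
    Prop :=
  forall j, j != k -> a`_j = 0.

Definition git_scalar N (X : cone N) H d (c : C) (a : git_ring X H d) : Prop :=
  git_poly a = (fun=> c)%:P.

(* Every C-subalgebra containing the degree one part is the whole ring. *)
Definition generated_in_degree1 N (X : cone N) H d : Prop :=
  forall S : {pred git_ring X H d},
    subring_closed S ->
    (forall c a, git_scalar c a -> a \in S) ->
    (forall a, git_homogeneous 1 a -> a \in S) ->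
    forall a, a \in S.

(* Projective normality of H \\ X^ss(O(d)) with respect to the descent of
   O(d). *)
Definition git_projectively_normal N (X : cone N) (H : set 'M[C]_N) (d : nat) :
    Prop :=
  integrally_closed (git_ring X H d) /\ @generated_in_degree1 N X H d.

End Cone.

Section Grassmannian.
Context {C : closedFieldType}.
Variables n r : nat.

(* Increasing sequences i_1 < ... < i_r of indices; they index the basis
   e_(i_1) /\ ... /\ e_(i_r) of /\^r C^n. *)
Definition increasing (f : {ffun 'I_r -> 'I_n}) : bool :=
  [forall i : 'I_r, forall j : 'I_r, (i < j)%N ==> (f i < f j)%N].

Definition incr_seq : Type := {f | increasing f}.
HB.instance Definition _ := Finite.on incr_seq.

Definition incr (k : 'I_#|{: incr_seq}|) : 'I_r -> 'I_n := val (enum_val k).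

(* Coordinates of a_1 /\ ... /\ a_r, the a_j being the columns of A. *)
Definition wedge (A : 'M[C]_(n, r)) : 'cV[C]_#|{: incr_seq}| :=
  \col_k \det (rowsub (incr k) A).

(* Matrix of /\^r g on /\^r C^n. *)
Definition ext_mx (g : 'M[C]_n) : 'M[C]_#|{: incr_seq}| :=
  \matrix_(k, l) \det (mxsub (incr k) (incr l) g).

Definition Grassmannian_set : set 'cV[C]_#|{: incr_seq}| :=
  [set v | v != 0 /\ exists A, v = wedge A].

Lemma Grassmannian_pt :
  (r <= n)%N -> wedge (pid_mx r) \in Grassmannian_set.
Proof.
move=> le_rn; rewrite inE; split; last by exists (pid_mx r).
have fP : increasing [ffun i : 'I_r => widen_ord le_rn i].
  apply/forallP=> i; apply/forallP=> j; rewrite !ffunE; exact/implyP.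
pose f : incr_seq := exist (fun f => increasing f) _ fP.
apply/eqP => /matrixP/(_ (enum_rank f) 0); rewrite !mxE.
suff -> : rowsub (incr (enum_rank f)) (pid_mx r) = 1%:M :> 'M[C]_r.
  by rewrite det1 => /eqP; rewrite oner_eq0.
apply/matrixP => i j; rewrite !mxE /incr enum_rankK /= ffunE /=.
by rewrite ltn_ord andbT.
Qed.

Definition Grassmannian (le_rn : (r <= n)%N) : cone #|{: incr_seq}| :=
  Cone (Grassmannian_pt le_rn).

End Grassmannian.

Arguments Grassmannian C {n r} le_rn.
Arguments git_projectively_normal {C N} X H d.

(* Main.v *)
(* Let q be r if r <= 2 and n - r otherwise, so that q is 1 or 2. The cone over
   the Grassmannian is parametrized by the n x q matrices A of rank q, through
   their maximal minors or, if q = n - r, through the complementary ones; and T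
   is conjugate to the diagonal torus. A generic line of matrices through a point
   of rank q stays in rank q, and a rational function which is polynomial on
   generic lines through a point is a polynomial; hence sections of O(m) are
   polynomials in A. Invariant sections of O(n k) become SL_q-invariant
   polynomials of degree q k in each row. For q = 1 these are the multiples of
   (x_1 ... x_n)^k. For q = 2 the first fundamental theorem expresses them by
   products of brackets [i j] over the edges of 2k-regular multigraphs on n
   vertices, and by Petersen's theorem such a multigraph is a union of k
   2-factors, each of which is an invariant section of degree one.
   An integral fraction a / b is polynomial on every line, since F[t] is
   integrally closed, so it is a polynomial in A; it inherits the invariance of
   a and b, so its components are again invariant sections. *)
Require Import Defs.
From mathcomp Require Import all_boot all_order all_fingroup all_algebra all_solvable all_field.
From mathcomp Require Import mpoly ring.

Set Implicit Arguments.
Unset Strict Implicit.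
Unset Printing Implicit Defensive.

Import Order.TTheory GRing.Theory Num.Theory.
Local Open Scope ring_scope.

(** * Marriage theorem and 2-factors *)

(** Sections are given only by local fractions on the cone, so a global polynomial has to be
    produced. Matrices of rank less than q have codimension n - q + 1, at least 2 because q < n;
    this is why a generic line through a full-rank matrix avoids them, and division can be done in
    one variable. The genericity of a direction must be an explicit nonzero polynomial: it is the
    determinant of a Krylov matrix. Working with matrices instead of Plücker coordinates puts
    everything inside a polynomial ring. The cases r and n - r are not related by an isomorphism of
    quotients: both parametrizations satisfy the interfaces [minors_param] and [param_action], from
    which the rest follows. The bound q <= 2 enters only through the description of invariants. For
    q = 2 the even degree 2k gives an Eulerian orientation, and this turns 2-factors into perfect
    matchings of a bipartite graph. *)

Section Hall.
Variable T : finType.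
Implicit Types (S A B : {set T}) (r : T -> {set T}).

Lemma bigcup_setDl A r B :
  \bigcup_(z in A) (r z :\: B) = (\bigcup_(z in A) r z) :\: B.
Proof.
apply/setP => y; apply/bigcupP/setDP => [[z zA /setDP[yr yN]]|[]].
  by split=> //; apply/bigcupP; exists z.
by case/bigcupP => z zA yr yN; exists z => //; apply/setDP.
Qed.

(** Induction on the size of S. If some nonempty proper subset A is tight, A is matched inside its
    neighbourhood N and the rest outside N. Otherwise every nonempty proper subset has one neighbour
    to spare, so any single pair x, y may be matched and removed. *)
Lemma hall_marriage S r :
  (forall A, A \subset S -> (#|A| <= #|\bigcup_(x in A) r x|)%N) ->
  exists f : T -> T, {in S &, injective f} /\ {in S, forall x, f x \in r x}.
Proof.
have [k] := ubnP #|S|; elim: k S r => // k IH S r; rewrite ltnS => leSk hall.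
have [->|[x xS]] := set_0Vmem S.
  by exists id; split=> [x y|x]; rewrite inE.
have [/existsP[A /and3P[pA A0 tight]]|] :=
  boolP [exists A : {set T}, [&& A \proper S, A != set0 &
     (#|\bigcup_(x in A) r x| <= #|A|)%N]].
  have sAS := proper_sub pA; pose N := \bigcup_(x in A) r x.
  have [|B sBA|f [finj fr]] := IH A r.
  - exact: leq_trans (proper_card pA) leSk.
  - by apply: hall; exact: subset_trans sBA sAS.
  (* Hall's condition survives outside N: apply it to A together with B and subtract the tight count
     for A. *)
  have [||g [ginj gr]] := IH (S :\: A) (fun z => r z :\: N).
  - apply: leq_trans leSk; apply: proper_card; rewrite properE subsetDl /=.
    apply: contra A0 => sSA; rewrite -subset0; apply/subsetP => z zA.
    by have := subsetP sSA z (subsetP sAS z zA); rewrite inE zA.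
  - move=> B; rewrite subsetD => /andP[sBS dBA].
    have := hall (A :|: B); rewrite subUset sAS sBS => /(_ isT).
    rewrite cardsU disjoint_setI0 1?disjoint_sym // cards0 subn0 => h.
    rewrite -(leq_add2l #|A|); apply: (leq_trans h).
    rewrite bigcup_setDl bigcup_setU -/N.
    have -> : N :|: \bigcup_(z in B) r z = N :|: (\bigcup_(z in B) r z) :\: N.
      by rewrite setDE setUIr setUCr setIT.
    by rewrite cardsU (leq_trans (leq_subr _ _)) // leq_add2r.
  have gN z : z \in S -> z \notin A -> g z \notin N.
    by move=> zS zA; have := gr z; rewrite !inE zS zA => /(_ isT)/andP[].
  have fN z : z \in A -> f z \in N.
    by move=> zA; apply/bigcupP; exists z => //; exact: fr.
  exists (fun z => if z \in A then f z else g z); split=> [y z yS zS|z zS].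
    have [yA|yA] := boolP (y \in A); have [zA|zA] := boolP (z \in A).
    + exact: finj.
    + by move=> e; have := gN z zS zA; rewrite -e fN.
    + by move=> e; have := gN y yS yA; rewrite e fN.
    + by apply: ginj; rewrite inE ?yA ?zA.
  case: ifPn => zA; first exact: fr.
  by have := gr z; rewrite !inE zA zS => /(_ isT)/andP[].
move=> /existsPn strict.
have [y yr] : exists y, y \in r x.
  apply/set0Pn; rewrite -card_gt0.
  have := hall [set x]; rewrite sub1set xS => /(_ isT).
  by rewrite cards1 big_set1.
(* Deleting y costs each neighbourhood at most one element, which strictness pays for. *)
have [||f [finj fr]] := IH (S :\ x) (fun z => r z :\ y).
- by apply: leq_trans leSk; rewrite [in ltnRHS](cardsD1 x) xS.
- move=> A; rewrite subsetD1 => /andP[sAS xA].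
  have [->|A0] := eqVneq A set0; first by rewrite cards0.
  have := strict A; rewrite A0 properE sAS /=.
  have -> /= : ~~ (S \subset A) by apply: contra xA => /subsetP; apply.
  rewrite -ltnNge => h; rewrite bigcup_setDl -ltnS; apply: (leq_trans h).
  by rewrite (cardsD1 y) -add1n leq_add2r leq_b1.
exists (fun z => if z == x then y else f z); split=> [u v uS vS|z zS].
  have fy z : z \in S -> z != x -> f z != y.
    by move=> zS zx; have := fr z; rewrite !inE zS zx => /(_ isT)/andP[].
  case: (eqVneq u x) => [->|ux]; case: (eqVneq v x) => [->|vx] // e.
  + by have := fy v vS vx; rewrite -e eqxx.
  + by have := fy u uS ux; rewrite e eqxx.
  + by apply: finj => //; rewrite !inE ?ux ?vx.
case: eqP => [->//|/eqP zx].
by have := fr z; rewrite !inE zx zS => /(_ isT)/andP[].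
Qed.

End Hall.

Section TwoFactors.
Variable n : nat.
Local Notation edges := (seq ('I_n * 'I_n)).
Implicit Types (e : edges) (u : 'I_n * 'I_n) (v w : 'I_n).

(** Edges are ordered pairs so that the same lists serve as multigraphs and as orientations; a loop
    counts twice. *)
Definition edge_deg e v :=
  (count (fun u => u.1 == v) e + count (fun u => u.2 == v) e)%N.

(** Canonical form of an unoriented edge: two lists are the same multigraph when their images under
    [unor] agree up to permutation. *)
Definition unor u := if (u.1 <= u.2)%N then u else (u.2, u.1).

Lemma unorC v w : unor (v, w) = unor (w, v).
Proof. by rewrite /unor /=; case: ltngtP => // /val_inj ->. Qed.

Lemma unor_eq u v w : unor u = unor (v, w) -> u = (v, w) \/ u = (w, v).
Proof.
rewrite /unor; case: u => a b /=.
by case: ifP => _; case: ifP => _ [-> ->]; first [by left | by right].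
Qed.

Lemma perm_unor_cons u e e' : perm_eq (unor u :: map unor e) (map unor e') ->
  exists u' r, [/\ unor u' = unor u, perm_eq e' (u' :: r)
    & perm_eq (map unor e) (map unor r)].
Proof.
move=> p; have : unor u \in map unor e' by rewrite -(perm_mem p) mem_head.
case/mapP => u' u'e' e1; exists u', (rem u' e'); split=> //.
  exact: perm_to_rem.
have := perm_trans p (perm_map unor (perm_to_rem u'e')).
by rewrite /= -e1 perm_cons.
Qed.

Lemma perm_edge_deg e e' v : perm_eq e e' -> edge_deg e v = edge_deg e' v.
Proof. by move=> /seq.permP p; rewrite /edge_deg !p. Qed.

Lemma edge_deg_cons u e v :
  edge_deg (u :: e) v = ((u.1 == v) + (u.2 == v) + edge_deg e v)%N.
Proof. by rewrite /edge_deg /= addnACA. Qed.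

Lemma edge_deg_unor e v : edge_deg (map unor e) v = edge_deg e v.
Proof.
elim: e => // u e IH; rewrite map_cons !edge_deg_cons IH /unor.
by case: ifP => _ //=; rewrite (addnC (u.2 == v)).
Qed.

Definition balanced e :=
  forall v, count (fun u => u.1 == v) e = count (fun u => u.2 == v) e.

Lemma perm_balanced e e' : perm_eq e e' -> balanced e -> balanced e'.
Proof. by move=> /seq.permP p b v; rewrite -!p. Qed.

(* Two edges va, vb at v are replaced by ab, and ab is split again once the
   smaller graph has been oriented. *)
Lemma eulerian_orientation e : (forall v, ~~ odd (edge_deg e v)) ->
  exists e', perm_eq (map unor e) (map unor e') /\ balanced e'.
Proof.
have [k] := ubnP (size e); elim: k e => // k IH [_ _|[v a] r]; first by exists [::].
rewrite ltnS /= => szr ev; have [av|av] := eqVneq v a.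
  have [w|e' [p b]] := IH r szr.
    by have := ev w; rewrite edge_deg_cons /= -av addnn oddD odd_double.
  exists ((v, a) :: e'); split; first by rewrite /= perm_cons.
  by move=> w /=; rewrite av b.
have [b [r' [pr sz']]] : exists b r',
    perm_eq (map unor r) (map unor ((v, b) :: r')) /\ size r = (size r').+1.
  have : (0 < edge_deg r v)%N.
    have := ev v; rewrite edge_deg_cons /= eqxx eq_sym (negbTE av) /=.
    by case: (edge_deg r v).
  rewrite addn_gt0 -!has_count => /orP[]/hasP[[c d] ucr /= /eqP uv].
    subst c; exists d, (rem (v, d) r).
    split; first exact: (perm_map unor (perm_to_rem _)).
    by rewrite (perm_size (perm_to_rem ucr)).
  subst d; exists c, (rem (c, v) r).
  split; last by rewrite (perm_size (perm_to_rem ucr)).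
  by have := perm_map unor (perm_to_rem ucr); rewrite /= (unorC c).
have dr w : odd (edge_deg r w) = odd (edge_deg ((v, b) :: r') w).
  by rewrite -edge_deg_unor (perm_edge_deg _ pr) edge_deg_unor.
have [||e' [p bal]] := IH ((a, b) :: r').
- by rewrite /= -sz'.
- move=> w; have := ev w; rewrite edge_deg_cons oddD dr !edge_deg_cons !oddD /=.
  by rewrite !oddb; case: (v == w); case: (a == w); case: (b == w); do 2 case: (odd _).
have [u [r3 [uu pe pr3]]] := perm_unor_cons p.
have b3 := perm_balanced pe bal.
have pvr : perm_eq (map unor ((v, a) :: r)) (map unor ((v, a) :: (v, b) :: r3)).
  by rewrite /= perm_cons (perm_trans pr) //= perm_cons.
(* The new edge is split along the orientation it received: a to b becomes a to v to b, and b to a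
   becomes b to v to a, so v gains one edge in and one out. *)
have [uE|uE] := unor_eq uu; rewrite uE in b3.
  exists [:: (a, v), (v, b) & r3]; split.
    by rewrite (perm_trans pvr) //= (unorC v a).
  by move=> w; have := b3 w; rewrite /= addnCA => ->.
exists [:: (b, v), (v, a) & r3]; split.
  rewrite (perm_trans pvr) //= (unorC v b).
  by rewrite -[[:: _, _ & _]]/([:: _] ++ [:: _] ++ _) perm_catCA.
by move=> w; have := b3 w; rewrite /= addnCA => ->.
Qed.

(** In-degrees and out-degrees all equal k + 1, so the bipartite graph from tails to heads is
    regular. The edges leaving A all end in its neighbourhood, and counting them gives Hall's
    condition. *)
Lemma balanced_matching k e : balanced e -> (forall v, edge_deg e v = k.+1.*2) ->
  exists f : 'I_n -> 'I_n, injective f /\ forall v, (v, f v) \in e.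
Proof.
move=> bal deg.
have out v : count (fun u => u.1 == v) e = k.+1.
  by apply: double_inj; rewrite -addnn {2}bal; exact: deg.
have inn v : count (fun u => u.2 == v) e = k.+1 by rewrite -bal.
have [|f [finj fr]] := @hall_marriage _ [set: 'I_n] (fun v => [set w | (v, w) \in e]).
  move=> A _; set N := \bigcup_(x in A) _; rewrite -(leq_pmul2r (ltn0Sn k)).
  have cnt (P : 'I_n * 'I_n -> 'I_n) (B : {set 'I_n}) :
      (forall v, count (fun u => P u == v) e = k.+1) ->
      (#|B| * k.+1 = count (fun u => P u \in B) e)%N.
    move=> hP; rewrite -sum_nat_const (eq_bigr _ (fun v _ => esym (hP v))).
    under eq_bigr do rewrite -sum1_count.
    rewrite (exchange_big_dep predT) //= -sum1_count.
    rewrite [in RHS]big_mkcond; apply: eq_bigr => u _; rewrite sum1_card.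
    case: ifP => uB.
      rewrite (eq_card (B := pred1 (P u))) ?card1 // => w.
      by rewrite unfold_in /= inE eq_sym andbC; case: eqP => // ->.
    rewrite eq_card0 // => w; rewrite unfold_in /=.
    by apply/negP => /andP[wB /eqP e1]; rewrite e1 wB in uB.
  rewrite (cnt fst _ out) (cnt snd _ inn).
  rewrite (eq_in_count (a2 := fun u => (u \in e) && (u.1 \in A))) => [|u ->//].
  apply: sub_count => u /andP[ue uA]; apply/bigcupP; exists u.1 => //.
  by rewrite inE -surjective_pairing.
exists f; split=> [v w|v]; first by apply: finj; rewrite inE.
by have := fr v; rewrite !inE; apply.
Qed.

Lemma uniq_sub_perm (T : eqType) (s t : seq T) : uniq s -> {subset s <= t} ->
  exists r, perm_eq t (s ++ r).
Proof.
elim: s t => [|x s IH] t /=; first by exists t.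
case/andP => xs us st; have xt := st x (mem_head x s).
have [|r p] := IH (rem x t) us.
  move=> y ys; have := st y; rewrite inE ys orbT => /(_ isT).
  rewrite (perm_mem (perm_to_rem xt)) inE => /predU1P[yx|//].
  by rewrite -yx ys in xs.
by exists r; rewrite (perm_trans (perm_to_rem xt)) // perm_cons.
Qed.

Lemma edge_deg_cat e e' v : edge_deg (e ++ e') v = (edge_deg e v + edge_deg e' v)%N.
Proof. by rewrite /edge_deg !count_cat addnACA. Qed.

(** One Eulerian orientation serves for all factors: the edges from v to f v, with f injective, form
    a 2-factor made of the cycles of f, possibly with loops or double edges, and removing them
    leaves a balanced graph of degree lower by two. *)
Lemma petersen_two_factors k e : (forall v, edge_deg e v = k.*2) ->
  exists E : seq edges,
    [/\ size E = k, {in E, forall e', size e' = n /\ forall v, edge_deg e' v = 2}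
      & perm_eq (map unor e) (map unor (flatten E))].
Proof.
move=> deg; have [v|e1 [p1 bal1]] := @eulerian_orientation e.
  by rewrite deg odd_double.
have deg1 v : edge_deg e1 v = k.*2.
  by rewrite -edge_deg_unor -(perm_edge_deg _ p1) edge_deg_unor.
suff [E [sE hE pE]] : exists E : seq edges, [/\ size E = k,
    {in E, forall e', size e' = n /\ forall v, edge_deg e' v = 2}
    & perm_eq e1 (flatten E)].
  by exists E; split=> //; rewrite (perm_trans p1) // perm_map.
elim: k {e p1 deg} e1 bal1 deg1 => [|k IH] e bal deg.
  exists [::]; split=> //; case: e deg {bal} => // u e /(_ u.1).
  by rewrite edge_deg_cons eqxx.
have [f [finj fe]] := balanced_matching bal deg.
pose e0 := [seq (v, f v) | v <- enum 'I_n].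
have [||r pr] := @uniq_sub_perm _ e0 e.
- by rewrite map_inj_uniq ?enum_uniq // => v w [].
- by move=> u /mapP[v _ ->].
have c1 v : count (fun u => u.1 == v) e0 = 1%N.
  rewrite count_map (eq_count (a2 := pred1 v)) //.
  by rewrite count_uniq_mem ?enum_uniq ?mem_enum.
have c2 v : count (fun u => u.2 == v) e0 = 1%N.
  rewrite count_map (eq_count (a2 := pred1 (invF finj v))).
    by rewrite count_uniq_mem ?enum_uniq ?mem_enum.
  by move=> w /=; rewrite -{1}(f_invF finj v) (inj_eq finj).
have d0 v : edge_deg e0 v = 2 by rewrite /edge_deg c1 c2.
have [v|v|E [sE hE pE]] := IH r.
- by have := perm_balanced pr bal v; rewrite !count_cat c1 c2 => -[].
- have := deg v; rewrite (perm_edge_deg _ pr) edge_deg_cat d0 doubleS.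
  by rewrite add2n => -[].
exists (e0 :: E); split=> [|e'|]; first by rewrite /= sE.
  by rewrite inE => /predU1P[->|/hE//]; rewrite size_map size_enum_ord.
by rewrite (perm_trans pr) // perm_cat2l.
Qed.

End TwoFactors.

(** * Maximal minors *)

Section CauchyBinet.
Variable C : closedFieldType.
Variables n r : nat.
Local Notation N := #|{: incr_seq n r}|.
Implicit Types (f : {ffun 'I_r -> 'I_n}) (s : 'S_r) (k l : 'I_N).

Lemma incr_lt k (i j : 'I_r) : (i < j)%N -> (incr k i < incr k j)%N.
Proof. by move=> ij; have /forallP/(_ i)/forallP/(_ j)/implyP := valP (enum_val k); apply. Qed.

Lemma incr_inj k : injective (incr k).
Proof.
move=> i j e; apply/val_inj; case: (ltngtP i j) => // /(incr_lt k);
  by rewrite e ltnn.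
Qed.

(** An injective map factors uniquely as a permutation followed by an increasing sequence; this
    bijection groups the terms of an alternating sum into determinants. *)
Definition perm_incr (x : 'I_N * 'S_r) : {ffun 'I_r -> 'I_n} :=
  [ffun i => incr x.1 (x.2 i)].

Lemma perm_incr_inj : injective perm_incr.
Proof.
(* A strictly sorted list is determined by its elements, so the image of the map recovers the
   increasing sequence, and then the permutation. *)
have sorted_incr k : sorted (fun i j : 'I_n => (i < j)%N) (codom (incr k)).
  rewrite /codom /image_mem sorted_map.
  have := iota_ltn_sorted 0 r; rewrite -val_enum_ord sorted_map.
  by rewrite enumT; apply: sub_sorted => i j; exact: incr_lt.
move=> [k s] [l t] /ffunP e.
have kl : k = l.
  suff : codom (incr k) = codom (incr l).
    move/eq_in_map => kl; apply: enum_val_inj; apply: val_inj.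
    by apply/ffunP => i; apply: kl; exact: mem_enum.
  apply: (irr_sorted_eq _ _ (sorted_incr k) (sorted_incr l)) => [x y z||v].
  - exact: ltn_trans.
  - by move=> x; rewrite ltnn.
  apply/codomP/codomP => [[i ->]|[i ->]].
    exists (t ((s^-1)%g i)); have := e ((s^-1)%g i).
    by rewrite !ffunE /= permKV.
  exists (s ((t^-1)%g i)); have := e ((t^-1)%g i).
  by rewrite !ffunE /= permKV.
subst l; congr (_, _); apply/permP => i; apply: (incr_inj (k := k)).
by have := e i; rewrite !ffunE.
Qed.

Lemma perm_incr_surj f : injective f -> exists x, f = perm_incr x.
Proof.
move=> finj.
pose t := sort (fun i j : 'I_n => (i <= j)%N) (codom f).
have st : size t = r by rewrite size_sort size_codom card_ord.
have ut : uniq t by rewrite sort_uniq; exact/injectiveP.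
have sot : sorted (fun i j : 'I_n => (i < j)%N) t.
  have -> : sorted (fun i j : 'I_n => (i < j)%N) t = sorted ltn (map val t).
    by rewrite sorted_map.
  rewrite ltn_sorted_uniq_leq map_inj_uniq ?ut //=; last exact: val_inj.
  by rewrite sorted_map; apply: sort_sorted => i j; exact: leq_total.
have ft i : f i \in t by rewrite mem_sort; exact: codom_f.
have it i : (index (f i) t < r)%N by rewrite -[X in (_ < X)%N]st index_mem.
have sinj : injective (fun i => Ordinal (it i)).
  by move=> i j [] /(congr1 (nth (f i) t)); rewrite !nth_index // => /finj.
pose g : {ffun 'I_r -> 'I_n} := [ffun i : 'I_r => tnth (Tuple (introT eqP st)) i].
have gP : increasing g.
  apply/forallP => i; apply/forallP => j; apply/implyP => ij.
  rewrite !ffunE !(tnth_nth (f i)) /=.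
  apply: (sorted_ltn_nth _ _ sot) => //; rewrite ?inE ?st //.
  by move=> x y z; exact: ltn_trans.
pose G : incr_seq n r := exist (fun f => increasing f) g gP.
exists (enum_rank G, perm sinj); apply/ffunP => i.
by rewrite ffunE /= /incr enum_rankK /= ffunE permE (tnth_nth (f i)) /= nth_index.
Qed.

(* An alternating form on the columns of Y is a combination of the maximal
   minors of Y. *)
Lemma alternating_minors (u : {ffun 'I_r -> 'I_n} -> C) (Y : 'M[C]_(n, r)) :
  (forall f, ~ injective f -> u f = 0) ->
  (forall f s, u [ffun i => f (s i)] = (-1) ^+ s * u f) ->
  \sum_(f : {ffun 'I_r -> 'I_n}) (\prod_i Y (f i) i) * u f =
  \sum_k \det (rowsub (incr k) Y) * u [ffun i => incr k i].
Proof.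
move=> u0 us.
rewrite (bigID (fun f => injectiveb f)) /= [X in _ + X]big1 ?addr0; last first.
  by move=> f /injectiveP/u0 ->; rewrite mulr0.
rewrite (eq_bigl (fun f => f \in [set perm_incr x | x in [set: 'I_N * 'S_r]])); last first.
  move=> f; apply/injectiveP/imsetP => [/perm_incr_surj[x ->]|[[k s] _ ->]].
    by exists x; rewrite ?inE.
  by move=> i j; rewrite !ffunE => /incr_inj/perm_inj.
rewrite big_imset /= => [|x y _ _]; last exact: perm_incr_inj.
rewrite (eq_bigl predT) => [|x]; last by rewrite inE.
rewrite -(pair_bigA _ (fun k s => (\prod_i Y (perm_incr (k, s) i) i) * u (perm_incr (k, s)))) /=.
apply: eq_bigr => k _; rewrite -det_tr /determinant mulr_suml.
apply: eq_bigr => s _.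
have -> : perm_incr (k, s) = [ffun i => [ffun i => incr k i] (s i)].
  by apply/ffunP => i; rewrite !ffunE.
rewrite us mulrA; congr (_ * _); rewrite mulrC; congr (_ * _).
by apply: eq_bigr => i _; rewrite !mxE !ffunE.
Qed.

(** Each column of [Z *m Y] is a combination of columns of Z. Multilinearity gives a sum over all
    maps f, whose terms [\det (colsub f Z)] alternate in f. *)
Lemma cauchy_binet (Z : 'M[C]_(r, n)) (Y : 'M[C]_(n, r)) :
  \det (Z *m Y) = \sum_k \det (rowsub (incr k) Y) * \det (colsub (incr k) Z).
Proof.
transitivity (\sum_(f : {ffun 'I_r -> 'I_n}) (\prod_i Y (f i) i) * \det (colsub f Z)).
  rewrite -[LHS]det_tr [LHS]/determinant.
  under eq_bigr => s _.
    under eq_bigr => i _ do rewrite !mxE.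
    rewrite bigA_distr_bigA mulr_sumr /=.
    over.
  rewrite exchange_big /=; apply: eq_bigr => f _.
  rewrite -det_tr /determinant mulr_sumr; apply: eq_bigr => s _.
  rewrite mulrCA -big_split; congr (_ * _); apply: eq_bigr => i _ /=.
  by rewrite !mxE mulrC.
rewrite (alternating_minors (u := fun f => \det (colsub f Z))).
- apply: eq_bigr => k _; congr (_ * \det _).
  by apply/matrixP => i j; rewrite !mxE ffunE.
- move=> f ninj; have /existsP[i /existsP[j /andP[ij /eqP fij]]] :
      [exists i, exists j, (i != j) && (f i == f j)].
    apply/contraT => /existsPn h; case: ninj => i j e; apply/eqP/contraT => ij.
    by have := h i => /existsPn/(_ j); rewrite ij e eqxx.
  rewrite -det_tr (determinant_alternate ij) // => k.
  by rewrite !mxE fij.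
- move=> f s; have -> : colsub [ffun i => f (s i)] Z = col_perm s (colsub f Z).
    by apply/matrixP => i j; rewrite !mxE ffunE.
  by rewrite col_permE det_mulmx det_perm odd_permV mulrC.
Qed.

End CauchyBinet.

From mathcomp Require Import boolp classical_sets functions reals.
From mathcomp.real_closed Require Import complex.

(** * Polynomials on grids and on lines *)

Section Density.
Variable F : fieldType.

Lemma meval_muni n (p : {mpoly F[n.+1]}) (v : 'I_n.+1 -> F) :
  p.@[v] =
  (map_poly (meval (fun i : 'I_n => v (widen_ord (leqnSn n) i))) (muni p)).[v ord_max].
Proof.
rewrite muniE mevalE rmorph_sum horner_sum; apply: eq_bigr => m _.
rewrite /= map_polyZ hornerZ map_polyXn hornerXn /= mevalZ mevalX -mulrA.
congr (_ * _); rewrite big_ord_recr /=; congr (_ * _).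
by apply: eq_bigr => i _; rewrite mnmE.
Qed.

Lemma mcoeff_muni n (p : {mpoly F[n.+1]}) (u : 'X_{1..n.+1}) :
  (muni p)`_(u ord_max)@_[multinom u (widen_ord (leqnSn n) i) | i < n] = p@_u.
Proof.
rewrite muniE coef_sum raddf_sum /= [in RHS](mpolyE p) raddf_sum /=.
apply: eq_bigr => m _; rewrite !coefZ coefXn mulr_natr mcoeffZ mcoeffX.
case: (u ord_max =P m ord_max) => [e|ne]; last first.
  rewrite mulr0n mcoeff0 (_ : (m == u) = false) ?mulr0 //.
  by apply/eqP=> e; apply: ne; rewrite e.
rewrite mulr1n mcoeffZ mcoeffX; congr (_ * (nat_of_bool _)%:R).
apply/eqP/eqP => [/mnmP h|->//]; apply/mnmP => i.
case: (unliftP ord_max i) => [j ->|-> //].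
have := h j; rewrite !mnmE.
have -> // : widen_ord (leqnSn n) j = lift ord_max j.
by apply/val_inj; rewrite /= /bump leqNgt ltn_ord.
Qed.

(** Induction on the number of variables: with the others fixed on the grid, the polynomial in the
    last variable has more roots than its degree allows, so its coefficients vanish on the smaller
    grid. The set s is left free: integers serve for density, roots of unity for tori. *)
Lemma mpoly_grid_eq0 n (p : {mpoly F[n]}) (s : seq F) :
  uniq s -> (forall m i, m \in msupp p -> (m i < size s)%N) ->
  (forall v, (forall i, v i \in s) -> p.@[v] = 0) -> p = 0.
Proof.
move=> us; elim: n p => [|n IH] p ds p0.
  apply/mpolyP => m; have := p0 (fun=> 0); rewrite mcoeff0.
  rewrite {1}(nvar0_mpolyC p) mevalC => <-; last by case.
  by congr (_@__); apply/mnmP; case.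
apply/mpolyP => u; rewrite -mcoeff_muni !mcoeff0.
suff -> : (muni p)`_(u ord_max) = 0 by rewrite mcoeff0.
apply: IH => [m i|v hv].
  rewrite mcoeff_msupp => nz.
  pose w := [multinom (if unlift ord_max j is Some k then m k else u ord_max) | j < n.+1].
  have := ds w (widen_ord (leqnSn n) i); rewrite mcoeff_msupp -mcoeff_muni.
  have wE k : w (widen_ord (leqnSn n) k) = m k.
    rewrite mnmE (_ : widen_ord _ _ = lift ord_max k) ?liftK //.
    by apply/val_inj; rewrite /= /bump leqNgt ltn_ord.
  have -> : [multinom w (widen_ord (leqnSn n) k) | k < n] = m.
    by apply/mnmP => k; rewrite mnmE wE.
  by rewrite wE mnmE unlift_none; apply.
set q := map_poly (meval v) (muni p).
have -> : ((muni p)`_(u ord_max)).@[v] = q`_(u ord_max) by rewrite coef_map.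
suff -> : q = 0 by rewrite coef0.
apply: (@roots_geq_poly_eq0 _ q s) => //.
  apply/allP => t ts; apply/eqP.
  pose w j := if unlift ord_max j is Some k then v k else t.
  have <- : p.@[w] = q.[t].
    rewrite meval_muni /w unlift_none; congr (_.[_]).
    apply: eq_map_poly => z; apply: meval_eq => k.
    rewrite (_ : widen_ord _ _ = lift ord_max k) ?liftK //.
    by apply/val_inj; rewrite /= /bump leqNgt ltn_ord.
  by apply: p0 => j; rewrite /w; case: unliftP.
apply: (leq_trans (size_poly _ _)).
rewrite muniE; apply: (leq_trans (size_sum _ _ _)).
rewrite big_seq; elim/big_ind: _ => // [a b ha hb|m mp].
  by rewrite geq_max ha.
apply: (leq_trans (size_scale_leq _ _)).
by rewrite size_polyXn ds.
Qed.

End Density.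

Lemma uniq_natr (F : numFieldType) N :
  uniq [seq (i%:R : F) | i <- iota 0 N].
Proof.
by rewrite map_inj_uniq ?iota_uniq // => i j /eqP; rewrite eqr_nat => /eqP.
Qed.

Lemma mnm_lt_msize (R : nzRingType) n (p : {mpoly R[n]}) m i :
  m \in msupp p -> (m i < msize p)%N.
Proof.
move/msize_mdeg_lt; apply: leq_ltn_trans.
by rewrite mdegE (bigD1 i) //= leq_addr.
Qed.

Lemma mpoly_eval0 (F : numFieldType) n (p : {mpoly F[n]}) :
  (forall v, p.@[v] = 0) -> p = 0.
Proof.
move=> p0; apply: (@mpoly_grid_eq0 _ _ _ _ (uniq_natr F (msize p))) => // m i.
by rewrite size_map size_iota; exact: mnm_lt_msize.
Qed.

Lemma mpoly_eval_inj (F : numFieldType) n (p q : {mpoly F[n]}) :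
  (forall v, p.@[v] = q.@[v]) -> p = q.
Proof.
by move=> e; apply/eqP; rewrite -subr_eq0; apply/eqP/mpoly_eval0 => v;
  rewrite mevalB e subrr.
Qed.

Lemma mpoly_eval_generic (F : numFieldType) n (w p q : {mpoly F[n]}) :
  w != 0 -> (forall v, w.@[v] != 0 -> p.@[v] = q.@[v]) -> p = q.
Proof.
move=> w0 e; apply: (mulIf w0); apply: mpoly_eval_inj => v; rewrite !mevalM.
by have [->|/e->//] := eqVneq w.@[v] 0; rewrite !mulr0.
Qed.

(** The restriction of p to A + X B. The coefficient morphism f allows B to be a vector of
    indeterminates, so that one generic line specializes to all lines through A. *)
Definition line (R S : comNzRingType) (f : {rmorphism R -> S}) n (p : {mpoly R[n]})
    (A B : 'I_n -> S) : {poly S} :=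
  mmap (polyC \o f) (fun i => (A i)%:P + (B i) *: 'X) p.

Section Line.
Variables (R S : comNzRingType) (f : {rmorphism R -> S}) (n : nat).
Variables A B : 'I_n -> S.
Local Notation L := (fun p => @line R S f n p A B).

Lemma lineD p q : L (p + q) = L p + L q. Proof. exact: mmapD. Qed.
Lemma lineM p q : L (p * q) = L p * L q. Proof. by rewrite /line rmorphM. Qed.
Lemma lineZ c p : L (c *: p) = f c *: L p.
Proof. by rewrite /line mmapZ mul_polyC. Qed.
Lemma lineC c : L c%:MP = (f c)%:P. Proof. exact: mmapC. Qed.
Lemma lineX i : L 'X_i = (A i)%:P + B i *: 'X.
Proof. by rewrite /line mmapX mmap1U. Qed.
End Line.

Definition line0 (F : comNzRingType) n (p : {mpoly F[n]}) (A B : 'I_n -> F) :=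
  line idfun p A B.

Lemma horner_line (F : comNzRingType) n (p : {mpoly F[n]}) (A B : 'I_n -> F) t :
  (line0 p A B).[t] = p.@[fun i => A i + t * B i].
Proof.
rewrite /line0 /line /mmap mevalE horner_sum; apply: eq_bigr => m _ /=.
rewrite hornerCM /mmap1 horner_prod; congr (_ * _); apply: eq_bigr => i _.
by rewrite horner_exp hornerD hornerC hornerZ hornerX mulrC.
Qed.

Lemma line_map (R S S' : comNzRingType) (f : {rmorphism R -> S})
    (g : {rmorphism S -> S'}) n (p : {mpoly R[n]}) (A B : 'I_n -> S) :
  map_poly g (line f p A B) = line (g \o f) p (g \o A) (g \o B).
Proof.
rewrite /line /mmap rmorph_sum; apply: eq_bigr => m _ /=.
rewrite rmorphM /= map_polyC /mmap1 rmorph_prod; congr (_ * _).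
apply: eq_bigr => i _; rewrite rmorphXn rmorphD /= map_polyC /= map_polyZ.
by rewrite map_polyX.
Qed.

Section LineDvd.
Variables (F : numFieldType) (n : nat).

(* If b divides a along the line through A, the quotient is the truncation of
   the power series a / b; its coefficients are polynomials in the direction. *)
Lemma dvd_on_lines (a b w : {mpoly F[n]}) (A : 'I_n -> F) :
  b.@[A] != 0 -> w != 0 ->
  (forall B, w.@[B] != 0 -> line0 b A B %| line0 a A B) ->
  exists c, a = b * c.
Proof.
move=> bA w0 hd; pose e := (b.@[A])^-1.
pose U p := line (@mpolyC n F) p (fun i => (A i)%:MP) (fun i => 'X_i).
have UE p B : map_poly (meval B) (U p) = line0 p A B.
  rewrite line_map /line0 /line /mmap; apply: eq_bigr => m _ /=.
  rewrite mevalC; congr (_ * _); apply: eq_bigr => i _ /=.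
  by rewrite mevalC mevalXU.
(* D bounds the size of the restriction of a to every line through A, hence that of every
   quotient. *)
pose D := size (U a).
(* Dividing by the value of b at A makes the constant term 1. The truncated geometric series [ga]
   then inverts [U b] modulo X^D, and c is the truncated quotient evaluated at X = 1. *)
pose be := e%:MP *: U b.
pose ga := e%:MP *: \sum_(i < D) (1 - be) ^+ i.
pose c := \sum_(i < D) (U a * ga)`_i.
have cE B : w.@[B] != 0 ->
    a.@[fun i => A i + B i] = b.@[fun i => A i + B i] * c.@[B].
  move=> wB; have /dvdpP[q qE] := hd B wB.
  have lb0 : line0 b A B != 0.
    apply: contraNneq bA => /(congr1 (fun p => p.[0])).
    rewrite horner_line horner0 => <-; apply/eqP.
    by apply: meval_eq => i; rewrite mul0r addr0.
  have sq : (size q <= D)%N.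
    have [->|q0] := eqVneq q 0; first by rewrite size_poly0.
    apply: leq_trans (_ : (size (line0 a A B) <= D)%N); last first.
      by rewrite -UE size_poly.
    rewrite qE size_mul // -ltnS prednK; last first.
      by rewrite addn_gt0 lt0n size_poly_eq0 q0.
    rewrite -[(size q).+1]addn1 leq_add2l lt0n size_poly_eq0 //.
  pose bB := e *: line0 b A B.
  have bB0 : (1 - bB)`_0 = 0.
    rewrite coefB coef1 coefZ -horner_coef0 horner_line.
    rewrite (_ : _.@[_] = b.@[A]) ?mulVf ?subrr //.
    by apply: meval_eq => i; rewrite mul0r addr0.
  have beE : map_poly (meval B) be = bB.
    by rewrite map_polyZ /= mevalC UE.
  have gaE : line0 b A B * map_poly (meval B) ga = 1 - (1 - bB) ^+ D.
    rewrite map_polyZ /= mevalC rmorph_sum -scalerAr scalerAl -/bB.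
    rewrite -[in X in X * _ = _](subKr 1 bB) -opprB mulNr.
    rewrite (eq_bigr (fun i : 'I_D => (1 - bB) ^+ i)) => [|i _]; last first.
      by rewrite rmorphXn rmorphB rmorph1 /= beE.
    by rewrite -subrX1 opprB.
  have -> : c.@[B] = q.[1].
    rewrite (horner_coef_wide _ sq) raddf_sum; apply: eq_bigr => i _ /=.
    rewrite expr1n mulr1 -coef_map rmorphM /= UE qE -mulrA gaE mulrBr mulr1.
    rewrite coefB -[1 - bB in X in _ - X](poly_take_drop 1).
    have -> : take_poly 1 (1 - bB) = 0.
      apply/polyP => -[|j]; rewrite coef_take_poly ?coef0 //.
    by rewrite add0r expr1 exprMn mulrA coefMXn ltn_ord subr0.
  have := congr1 (fun p => p.[1]) qE; rewrite hornerM !horner_line mulrC.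
  suff -> : (fun i => A i + 1 * B i) = (fun i => A i + B i) by [].
  by apply/funext => i; rewrite mul1r.
(* So far c is a function of the direction; the translation by A turns it into a function of the end
   point. *)
pose sh (p : {mpoly F[n]}) := p \mPo [tuple 'X_i - (A i)%:MP | i < n].
have shE p v : (sh p).@[v] = p.@[fun i => v i - A i].
  rewrite comp_mpoly_meval; apply: meval_eq => i.
  by rewrite tnth_mktuple mevalB mevalXU mevalC.
exists (sh c); apply: (@mpoly_eval_generic _ _ (sh w)).
  apply: contraNneq w0 => s0; apply/eqP/mpoly_eval0 => v.
  have := shE w (fun i => v i + A i); rewrite s0 meval0 => ->.
  by apply: meval_eq => i; rewrite addrK.
move=> v; rewrite mevalM !shE => /cE.
suff -> : (fun i => A i + (v i - A i)) = v by [].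
by apply/funext => i; rewrite addrC subrK.
Qed.

Lemma line_coef0 (p : {mpoly F[n]}) (A B : 'I_n -> F) : (line0 p A B)`_0 = p.@[A].
Proof.
rewrite -horner_coef0 horner_line; apply: meval_eq => i.
by rewrite mul0r addr0.
Qed.

Lemma line_coef1 (p : {mpoly F[n]}) (A B : 'I_n -> F) :
  (line0 p A B)`_1 = \sum_i B i * p^`M(i).@[A].
Proof.
pose P p := (line0 p A B)`_1 = \sum_i B i * p^`M(i).@[A].
have PM q r : P q -> P r -> P (q * r).
  rewrite /P /line0 lineM coefM !big_ord_recl big_ord0 addr0 => hq hr.
  rewrite hq hr !line_coef0 mulr_sumr mulr_suml -big_split; apply: eq_bigr => i _.
  rewrite mderivM mevalD !mevalM /=; ring.
have P1 : P 1.
  rewrite /P /line0 -mpolyC1 lineC coefC big1 // => i _.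
  by rewrite mderivC meval0 mulr0.
have PX i : P 'X_i.
  rewrite /P /line0 lineX coefD coefC coefZ coefX add0r mulr1 (bigD1 i) //=.
  rewrite mderivX mnm1E eqxx scale1r mevalX big1 => [|k _].
    rewrite mulr1 big1 ?addr0 // => j ji.
    by rewrite mderivX mnm1E eq_sym (negbTE ji) scale0r meval0 mulr0.
  by rewrite mnmBE subnn expr0.
elim/mpolyind: p => [|c m p _ _ IH].
  rewrite /line0 /line mmap0 coef0 big1 // => i _.
  by rewrite mderiv0 meval0 mulr0.
have {}PX : P 'X_[m].
  rewrite mpolyXE_id; apply: (big_ind P) => // i _.
  by elim: (m i) => [|k]; rewrite ?expr0 // exprS => /(PM _ _ (PX i)).
rewrite /line0 lineD lineZ coefD coefZ -/(line0 _ _ _) -/(line0 _ _ _) PX IH.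
rewrite mulr_sumr -big_split; apply: eq_bigr => i _ /=.
rewrite mderivD mderivZ mevalD mevalZ; ring.
Qed.

End LineDvd.

(** * Invariants of SL_2 *)

Lemma mxvec_index_eq n q (i k : 'I_n) (a b : 'I_q) :
  (mxvec_index i a == mxvec_index k b) = (i == k) && (a == b).
Proof. by rewrite (inj_eq (@cast_ord_inj _ _ _)) (inj_eq enum_rank_inj) xpair_eqE. Qed.

Lemma sum_mxvec (V : nmodType) n q (F : 'I_(n * q) -> V) :
  \sum_k F k = \sum_i \sum_j F (mxvec_index i j).
Proof.
rewrite pair_bigA (reindex _ (curry_mxvec_bij _ _)) /=.
by apply: eq_bigr => -[i j].
Qed.

Section LinComb.
Variables (R : comNzRingType) (V : lalgType R).
Implicit Type G : V -> Prop.

Definition lincomb G p :=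
  exists s : seq (R * V), {in s, forall c, G c.2} /\ p = \sum_(c <- s) c.1 *: c.2.

Lemma lincomb0 G : lincomb G 0.
Proof. by exists [::]; rewrite big_nil. Qed.

Lemma lincombD G p q : lincomb G p -> lincomb G q -> lincomb G (p + q).
Proof.
move=> [s [hs ->]] [t [ht ->]]; exists (s ++ t); rewrite big_cat; split=> // c.
by rewrite mem_cat => /orP[/hs|/ht].
Qed.

Lemma lincombZ G a p : lincomb G p -> lincomb G (a *: p).
Proof.
move=> [s [hs ->]]; exists [seq (a * c.1, c.2) | c <- s]; split=> [c|].
  by case/mapP => c' /hs h ->.
by rewrite big_map scaler_sumr; apply: eq_bigr => c _; rewrite scalerA.
Qed.

Lemma lincomb_sum G I (r : seq I) (P : pred I) F :
  (forall i, P i -> lincomb G (F i)) -> lincomb G (\sum_(i <- r | P i) F i).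
Proof. by move=> h; elim/big_ind: _ => //; [exact: lincomb0 | exact: lincombD]. Qed.

Lemma lincomb1 G p : G p -> lincomb G p.
Proof.
move=> Gp; exists [:: (1, p)]; rewrite big_seq1 scale1r; split=> // c.
by rewrite inE => /eqP ->.
Qed.

Lemma lincomb_trans G G' p :
  (forall g, G g -> lincomb G' g) -> lincomb G p -> lincomb G' p.
Proof.
move=> h [s [hs ->]]; rewrite big_seq; apply: lincomb_sum => c /hs/h.
exact: lincombZ.
Qed.
End LinComb.

(** Euler's identity read on coefficients, so that no homogeneity is assumed. *)
Lemma mcoeff_euler (R : comNzRingType) N (p : {mpoly R[N]}) u :
  (\sum_k 'X_k * p^`M(k))@_u = (mdeg u)%:R * p@_u.
Proof.
rewrite {1}(mpolyE p) (eq_bigr (fun k => \sum_(m <- msupp p) (p@_m * (m k)%:R) *: 'X_[m])).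
  rewrite exchange_big /= raddf_sum /=.
  rewrite [in RHS](mpolyE p) (raddf_sum (mcoeff u)) mulr_sumr; apply: eq_bigr => m _ /=.
  rewrite raddf_sum /= mcoeffZ mcoeffX.
  rewrite (eq_bigr (fun k => (m k)%:R * (p@_m * (m == u)%:R))) => [|k _]; last first.
    by rewrite mcoeffZ mcoeffX; ring.
  rewrite -mulr_suml -natr_sum -mdegE.
  by case: eqP => [->|_]; rewrite ?mulr0.
move=> k _; rewrite linear_sum mulr_sumr; apply: eq_bigr => m _.
rewrite /= mderivZ mderivX -!scalerAr scalerA; have [->|mk] := posnP (m k).
  by rewrite mulr0 !scale0r.
by rewrite -mpolyXD addmC submK // lep1mP -lt0n.
Qed.

Lemma ord2_cases (c : 'I_2) : c = 0 \/ c = 1.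
Proof. by case: c => -[|[|//]] ?; [left | right]; exact/val_inj. Qed.

Section FFT.
Variables (F : numFieldType) (n : nat).
Implicit Types (f g : {mpoly F[n * 2]}) (i j l : 'I_n) (a b c : 'I_2).

Local Notation "''x_' ( i , a )" := ('X_(mxvec_index i a) : {mpoly F[n * 2]}).
Local Notation "''d_' ( i , a ) f" := (mderiv (mxvec_index i a) f)
  (at level 10, f at level 8).

Definition bracket i j : {mpoly F[n * 2]} :=
  'x_(i, 0) * 'x_(j, 1) - 'x_(i, 1) * 'x_(j, 0).
(** The polarization operator: the elementary matrix with a 1 at (a, b) in gl_2, acting through
    right multiplication on the rows. *)
Definition row_pol a b f := \sum_j 'x_(j, a) * 'd_(j, b) f.
Definition row_deg l f := \sum_a 'x_(l, a) * 'd_(l, a) f.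
(** Cayley's Omega operator on the rows i and j. *)
Definition omega i j f := 'd_(i, 0) ('d_(j, 1) f) - 'd_(i, 1) ('d_(j, 0) f).

Lemma mderiv_X i a j b : 'd_(i, a) 'x_(j, b) = ((i == j) && (a == b))%:R.
Proof.
rewrite mderivX mnm1E eq_sym mxvec_index_eq; case: andP => [[/eqP-> /eqP->]|_].
  by rewrite scale1r -{1}[U_(_)%MM]add0m addmK mpolyX0.
by rewrite scale0r.
Qed.

Lemma mderiv_row_pol i c a b f :
  'd_(i, c) (row_pol a b f) = (c == a)%:R *: 'd_(i, b) f + row_pol a b ('d_(i, c) f).
Proof.
rewrite /row_pol raddf_sum /=; under eq_bigr do rewrite mderivM mderiv_X.
rewrite big_split /=; congr (_ + _).
  rewrite (bigD1 i) //= eqxx big1 ?addr0 => [|j ji].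
    by case: (c == a); rewrite ?mul1r ?scale1r ?mul0r ?scale0r.
  by rewrite eq_sym (negbTE ji) mul0r.
by apply: eq_bigr => j _; rewrite mderiv_comm.
Qed.

Lemma mderiv_row_deg i c l f :
  'd_(i, c) (row_deg l f) = (i == l)%:R *: 'd_(i, c) f + row_deg l ('d_(i, c) f).
Proof.
rewrite /row_deg raddf_sum /=; under eq_bigr do rewrite mderivM mderiv_X.
rewrite big_split /=; congr (_ + _).
  rewrite (bigD1 c) //= eqxx andbT big1 ?addr0 => [|a ac].
    by case: eqP => [->|_]; rewrite ?mul1r ?scale1r ?mul0r ?scale0r.
  by rewrite [c == a]eq_sym (negbTE ac) andbF mul0r.
by apply: eq_bigr => a _; rewrite mderiv_comm.
Qed.

Lemma row_polB a b f g : row_pol a b (f - g) = row_pol a b f - row_pol a b g.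
Proof. by rewrite /row_pol -sumrB; apply: eq_bigr => j _; rewrite mderivB mulrBr. Qed.

Lemma row_degB l f g : row_deg l (f - g) = row_deg l f - row_deg l g.
Proof. by rewrite /row_deg -sumrB; apply: eq_bigr => j _; rewrite mderivB mulrBr. Qed.

(** Infinitesimal form of f (A h) = (det h)^m f (A). *)
Definition sl2_semi_inv (m : nat) f :=
  forall a b, row_pol a b f = ((a == b)%:R * m%:R) *: f.

(** A Capelli-type identity. The sum regroups into polarizations of the derivatives of f; diagonal
    ones contribute the factor m, and commuting off-diagonal ones past a derivative contributes the
    extra 1. *)
Lemma sum_bracket_omega m f i : sl2_semi_inv m f ->
  \sum_j bracket i j * omega i j f = m.+1%:R *: row_deg i f.
Proof.
move=> hf.
have h a b c : row_pol a b ('d_(i, c) f) =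
    ((a == b)%:R * m%:R) *: 'd_(i, c) f - (c == a)%:R *: 'd_(i, b) f.
  by rewrite -mderivZ -hf mderiv_row_pol addrAC subrr add0r.
transitivity ('x_(i, 0) * row_pol 1 1 ('d_(i, 0) f) - 'x_(i, 0) * row_pol 1 0 ('d_(i, 1) f)
   - 'x_(i, 1) * row_pol 0 1 ('d_(i, 0) f) + 'x_(i, 1) * row_pol 0 0 ('d_(i, 1) f)).
  rewrite /row_pol !mulr_sumr -!sumrB -big_split; apply: eq_bigr => j _ /=.
  rewrite /bracket /omega !(mderiv_comm (mxvec_index j _) (mxvec_index i _)).
  by rewrite mulrBl !mulrBr !mulrA opprB addrA addrAC.
rewrite !h /row_deg !big_ord_recl big_ord0 /= !mul1r !mul0r !scale0r !scale1r.
rewrite (_ : lift ord0 ord0 = 1) //; last exact/val_inj.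
by rewrite -!mul_mpolyC rmorph_nat; ring.
Qed.

(** Omega is a determinant of derivations, on which gl_2 acts by minus the trace, so it lowers the
    weight by one. *)
Lemma sl2_semi_inv_omega m f i j :
  sl2_semi_inv m.+1 f -> sl2_semi_inv m (omega i j f).
Proof.
move=> hf a b; have := hf a b => /(congr1 (omega i j)).
rewrite {1}/omega !mderiv_row_pol !mderivD !mderivZ !mderiv_row_pol.
rewrite {1}/omega !mderivZ -/(omega i j f) => h.
have -> : row_pol a b (omega i j f) = ((a == b)%:R * m.+1%:R) *: omega i j f
   - (1 == a)%:R *: ('d_(i, 0) ('d_(j, b) f) - 'd_(i, b) ('d_(j, 0) f))
   - (0 == a)%:R *: ('d_(i, b) ('d_(j, 1) f) - 'd_(i, 1) ('d_(j, b) f)).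
  rewrite /omega row_polB scalerBr -h !scalerBr; ring.
have [->|->] := ord2_cases a; have [->|->] := ord2_cases b;
  rewrite /omega -!mul_mpolyC !rmorphM !rmorph_nat /=; ring.
Qed.

Lemma row_deg_omega f (d : 'I_n -> F) i j l : (forall l, row_deg l f = d l *: f) ->
  row_deg l (omega i j f) = (d l - (i == l)%:R - (j == l)%:R) *: omega i j f.
Proof.
move=> hf; have := hf l => /(congr1 (omega i j)).
rewrite {1}/omega !mderiv_row_deg !mderivD !mderivZ !mderiv_row_deg.
rewrite {1}/omega !mderivZ => h.
rewrite /omega row_degB -!mul_mpolyC !rmorphB !rmorph_nat /=.
move: h; rewrite -!mul_mpolyC !rmorph_nat => h.
rewrite !mulrBl !mulrBr -h; ring.
Qed.

(* First fundamental theorem for SL_2, by induction on m: summing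
   [sum_bracket_omega] over i gives
   2 m (m + 1) f = sum_(i, j) [i j] Omega_ij f. *)
Lemma sl2_semi_inv_brackets m f (d : 'I_n -> F) :
  sl2_semi_inv m f -> (forall l, row_deg l f = d l *: f) ->
  lincomb (fun g => exists e, [/\ size e = m, forall l, (edge_deg e l)%:R = d l
     & g = \prod_(u <- e) bracket u.1 u.2]) f.
Proof.
elim: m f d => [|m IH] f d hf hd.
  (* In weight 0 both column degrees vanish, hence the total degree too, and f is constant. *)
  have euler u : (mdeg u)%:R * f@_u = 0.
    rewrite -mcoeff_euler sum_mxvec exchange_big /= raddf_sum big1 // => a _.
    by rewrite -/(row_pol a a f) hf mulr0 scale0r raddf0.
  have fC : f = f@_0 *: 1.
    apply/mpolyP => v; rewrite mcoeffZ mcoeff1; have [->|v0] := eqVneq v 0%MM.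
      by rewrite mulr1.
    have /eqP := euler v; rewrite mulf_eq0 pnatr_eq0 mdeg_eq0 (negbTE v0) /=.
    by move/eqP; rewrite mulr0.
  (* For f = 0 the row degrees d are arbitrary, and only the empty combination is available. *)
  have [f0|f0] := eqVneq f 0; first by rewrite f0; exact: lincomb0.
  rewrite fC; apply/lincombZ/lincomb1; exists [::]; split; rewrite ?big_nil // => l.
  have := hd l; rewrite {1}fC /row_deg big1 => [|a _].
    by move/esym/eqP; rewrite scaler_eq0 (negbTE f0) orbF => /eqP->.
  by rewrite mderivZ -mpolyC1 mderivC scaler0 mulr0.
(* Here the weight is m + 1. Summing row degrees over i gives the two column degrees, each equal to
   m + 1, and each identity carries a factor m + 2. *)
pose k : F := m.+2%:R * m.+1%:R *+ 2.
suff -> : f = k^-1 *: \sum_i \sum_j bracket i j * omega i j f.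
  apply/lincombZ/lincomb_sum => i _; apply: lincomb_sum => j _.
  have [s [hs ->]] := IH _ _ (sl2_semi_inv_omega i j hf) (fun l => row_deg_omega i j l hd).
  rewrite mulr_sumr big_seq; apply: lincomb_sum => c /hs [e [se de ->]].
  rewrite -scalerAr; apply/lincombZ/lincomb1; exists ((i, j) :: e); split.
  - by rewrite /= se.
  - move=> l; have -> : d l = (edge_deg e l)%:R + (i == l)%:R + (j == l)%:R.
      by rewrite de; ring.
    by rewrite /edge_deg /= !natrD; ring.
  - by rewrite big_cons.
under eq_bigr do rewrite (sum_bracket_omega _ hf).
rewrite -scaler_sumr /row_deg exchange_big /=.
rewrite (eq_bigr (fun a => m.+1%:R *: f)) => [|a _]; last first.
  by rewrite -/(row_pol a a f) hf eqxx mul1r.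
rewrite big_ord_recl big_ord1 -mulr2n scalerMnl !scalerA mulrnAr -/k.
rewrite  mulVf ?scale1r // /k mulrn_eq0 /= mulf_eq0 !pnatr_eq0 //.
Qed.

End FFT.

(** * Sections as polynomials in a matrix *)

(** A rational function regular at every point of the line is a polynomial: at a root of the reduced
    denominator the local equation would make the reduced numerator vanish as well. *)
Lemma dvdp_local (C : closedFieldType) (a b : {poly C}) : b != 0 ->
  (forall t, exists u v, u.[t] != 0 /\ a * u = v * b) -> b %| a.
Proof.
move=> b0 loc; pose g := gcdp a b.
have g0 : g != 0 by rewrite gcdp_eq0 negb_and b0 orbT.
have /dvdpP[a' aE] : g %| a by exact: dvdp_gcdl.
have /dvdpP[b' bE] : g %| b by exact: dvdp_gcdr.
have cop : coprimep a' b'.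
  have : coprimep (a %/ g) (b %/ g) by apply: coprimep_div_gcd; rewrite b0 orbT.
  by rewrite aE bE !mulpK.
have [b'1|b'1] := eqVneq (size b') 1%N.
  have /size_poly1P[c c0 b'E] : size b' == 1%N by rewrite b'1.
  by rewrite bE aE b'E mul_polyC dvdpZl // dvdp_mull.
have /closed_rootP[t t0] := b'1.
have [u [v [ut e]]] := loc t.
have : a' * u = v * b' by apply: (mulIf g0); rewrite mulrAC -aE e bE mulrA.
move/(congr1 (fun p => p.[t])); rewrite !hornerM (rootP t0) mulr0 => /eqP.
rewrite mulf_eq0 (negbTE ut) orbF => at0.
by have := coprimep_root cop at0; rewrite (rootP t0) eqxx.
Qed.

Lemma full_col_rankP (F : fieldType) n q (A : 'M[F]_(n, q)) :
  reflect (forall v : 'cV_q, A *m v = 0 -> v = 0) (\rank A == q).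
Proof.
rewrite -mxrank_tr; apply: (iffP idP) => [fA v Av|inj].
  apply: trmx_inj; apply: (row_free_inj fA).
  by rewrite -trmx_mul Av !trmx0 mul0mx.
rewrite -[_ == q]/(row_free A^T) -kermx_eq0.
apply/eqP/row_matrixP => i; rewrite row0.
apply: trmx_inj; rewrite trmx0; apply: inj; apply: trmx_inj.
by rewrite trmx_mul trmxK trmx0 -row_mul mulmx_ker row0.
Qed.

Definition mxev (R : comNzRingType) m n (p : {mpoly R[m * n]}) (A : 'M[R]_(m, n)) : R :=
  p.@[fun k => mxvec A 0 k].

Definition mxpt (R : comNzRingType) m n (v : 'I_(m * n) -> R) : 'M[R]_(m, n) :=
  \matrix_(i, j) v (mxvec_index i j).

Lemma mxptK (R : comNzRingType) m n (v : 'I_(m * n) -> R) :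
  (fun k => mxvec (mxpt v) 0 k) = v.
Proof. by apply/funext => k; case/mxvec_indexP: k => i j; rewrite mxvecE mxE. Qed.

Lemma mxev_pt (R : comNzRingType) m n (p : {mpoly R[m * n]}) v :
  p.@[v] = mxev p (mxpt v).
Proof. by rewrite /mxev mxptK. Qed.

(** * Lines that stay among the matrices of full rank *)

Section Krylov.
Variables (C : numFieldType) (n q : nat) (q_lt_n : (q < n)%N).

(** With M the top square block of B and b the row below it, the rows are b, b M, ..., b M^(q-1).
    Invertibility ensures that no eigenvector of M is killed by b. The ring is arbitrary so that the
    entries can be generic. *)
Definition krylov (R : comNzRingType) (B : 'M[R]_(n, q)) : 'M[R]_q :=
  \matrix_(i, j) (iter i (mulmx^~ (rowsub (widen_ord (ltnW q_lt_n)) B))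
                         (row (Ordinal q_lt_n) B)) 0 j.

Lemma map_krylov (R S : comNzRingType) (f : {rmorphism R -> S}) (B : 'M_(n, q)) :
  map_mx f (krylov B) = krylov (map_mx f B).
Proof.
apply/matrixP => i j; rewrite !mxE; elim: (nat_of_ord i) j => [|k IH] j /=.
  by rewrite !mxE.
by rewrite !mxE rmorph_sum; apply: eq_bigr => l _; rewrite rmorphM IH !mxE.
Qed.

Definition krylov_poly : {mpoly C[n * q]} :=
  \det (krylov (\matrix_(i, j) 'X_(mxvec_index i j))).

Lemma mxev_krylov B : mxev krylov_poly B = \det (krylov B).
Proof.
rewrite /mxev -det_map_mx map_krylov; congr (\det (krylov _)).
by apply/matrixP => i j; rewrite !mxE /= mevalXU mxvecE.
Qed.

Lemma krylov_poly_neq0 : krylov_poly != 0.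
Proof.
(* M is the shift sending each basis row to the next and b is the first basis row, so the Krylov
   matrix is the identity. *)
pose B : 'M[C]_(n, q) := \matrix_(i, j)
  (if (i < q)%N then i.+1 == j :> nat else j == 0%N :> nat)%:R.
suff : mxev krylov_poly B != 0 by apply: contraNneq => ->; rewrite /mxev meval0.
rewrite mxev_krylov; have -> : krylov B = 1%:M; last by rewrite det1 oner_eq0.
apply/matrixP => i j; rewrite !mxE.
rewrite -val_eqE /=.
have : (i < q)%N by []; elim: (nat_of_ord i) j => [|l IH] j lq /=.
  by rewrite !mxE /= ltnn eq_sym.
rewrite !mxE (bigD1 (Ordinal (ltnW lq))) //= big1 => [|h hl].
  by rewrite IH ?(ltnW lq) //= eqxx mul1r addr0 !mxE /= (ltnW lq).
by rewrite IH ?(ltnW lq) //= eq_sym (_ : _ == _ = false) ?mul0r //; apply/negbTE.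
Qed.

(* A rank drop at [pid_mx q + t *: B] yields an eigenvector of the top block of B
   that is killed by the next row of B, hence by the Krylov matrix. *)
Lemma krylov_line_rank (B : 'M[C]_(n, q)) t : \det (krylov B) != 0 ->
  \rank ((pid_mx q + t *: B)%R : 'M[C]_(n, q)) == q.
Proof.
move=> KB; apply/full_col_rankP => v; rewrite mulmxDl -scalemxAl => Av.
have rv i : row i (pid_mx q *m v) = - t *: (row i B *m v).
  by rewrite -row_mul scaleNr -linearZ -linearN; congr (row i _); apply/eqP;
    rewrite -addr_eq0 Av.
have top : v = - t *: (rowsub (widen_ord (ltnW q_lt_n)) B *m v).
  apply/row_matrixP => i; rewrite linearZ /=.
  have := rv (widen_ord (ltnW q_lt_n) i).
  have -> : row (widen_ord (ltnW q_lt_n) i) (pid_mx q *m v) = row i v.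
    rewrite !row_mul; apply/rowP => j; rewrite !mxE (bigD1 i) //= big1 => [|k ki].
      by rewrite !mxE /= eqxx ltn_ord mul1r addr0.
    by rewrite !mxE /= eq_sym (_ : _ == _ = false) ?mul0r //; apply/negbTE.
  by move=> ->; rewrite row_mul; congr (_ *: (_ *m _)); apply/rowP => j; rewrite !mxE.
have [t0|t0] := eqVneq t 0; first by rewrite top t0 oppr0 scale0r.
have bv : row (Ordinal q_lt_n) B *m v = 0.
  have := rv (Ordinal q_lt_n).
  have -> : row (Ordinal q_lt_n) (pid_mx q *m v) = 0.
    rewrite row_mul (_ : row _ _ = 0) ?mul0mx //.
    by apply/rowP => j; rewrite !mxE /= ltnn andbF.
  by move/esym/eqP; rewrite scaler_eq0 oppr_eq0 (negbTE t0) /= => /eqP.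
have Bv : rowsub (widen_ord (ltnW q_lt_n)) B *m v = (- t)^-1 *: v.
  by rewrite {2}top scalerA mulVf ?oppr_eq0 // scale1r.
have Kv : krylov B *m v = 0.
  apply/row_matrixP => i; rewrite row0 row_mul.
  have -> : row i (krylov B) = iter i (mulmx^~ (rowsub (widen_ord (ltnW q_lt_n)) B))
       (row (Ordinal q_lt_n) B) by apply/rowP => j; rewrite !mxE.
  elim: (nat_of_ord i) => [|l IH] //=.
  by rewrite -mulmxA Bv -scalemxAr IH scaler0.
have KU : krylov B \in unitmx by rewrite unitmxE unitfE.
by rewrite -[v](mulKmx KU) Kv mulmx0.
Qed.

End Krylov.

(** What the two parametrizations share. [param_minor] reads every minor of A as a linear form on
    the cone, and [param_mulr] says that a change of frame rescales the representative of a
    point. *)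
Record minors_param (C : numClosedFieldType) n q N (X : cone N)
    (psi : 'M[C]_(n, q) -> 'cV[C]_N) : Prop := MinorsParam {
  param_poly : forall k, exists p, forall A, psi A k 0 = mxev p A;
  param_minor : forall Z : 'M_(q, n), exists u : 'rV_N,
    forall A, \det (Z *m A) = (u *m psi A) 0 0;
  param_mulr : forall A h, psi (A *m h) = \det h *: psi A;
  param_cone : forall v, cone_set X v <-> exists A, \rank A = q /\ v = psi A }.

Section Param.
Variables (C : numClosedFieldType) (n q N : nat) (q_lt_n : (q < n)%N).
Variables (X : @cone C N) (psi : 'M[C]_(n, q) -> 'cV[C]_N).
Hypothesis psiP : minors_param X psi.

Lemma cpoint_param (x : cpoint X) : exists A, \rank A = q /\ val x = psi A.
Proof. by apply/(param_cone psiP); apply: set_mem; exact: valP. Qed.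

Lemma param_cpoint A : \rank A = q -> exists x : cpoint X, val x = psi A.
Proof.
move=> rA; have XA : psi A \in cone_set X.
  by apply/mem_set/(param_cone psiP); exists A.
by exists (exist _ (psi A) XA).
Qed.

Lemma param_pullback : exists pull : {rmorphism {mpoly C[N]} -> {mpoly C[n * q]}},
  forall p A, mxev (pull p) A = p.@[fun i => psi A i 0].
Proof.
pose pp k := projT1 (cid (param_poly psiP k)).
exists (comp_mpoly [tuple pp k | k < N]) => p A.
rewrite /mxev comp_mpoly_meval; apply: meval_eq => i; rewrite tnth_mktuple.
by rewrite (projT2 (cid (param_poly psiP i))).
Qed.

Lemma minor_poly (Z : 'M[C]_(q, n)) :
  exists w : {mpoly C[n * q]}, forall A, mxev w A = \det (Z *m A).
Proof.
have [pull pullE] := param_pullback.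
have [u uE] := param_minor psiP Z.
exists (pull (\sum_k u 0 k *: 'X_k)) => A.
rewrite pullE uE mxE raddf_sum /=; apply: eq_bigr => k _.
by rewrite mevalZ mevalXU.
Qed.

Lemma det_mul_rank (Z : 'M[C]_(q, n)) (A : 'M[C]_(n, q)) :
  \det (Z *m A) != 0 -> \rank A = q.
Proof.
move=> d; apply/eqP; rewrite eqn_leq rank_leq_col /=.
have : Z *m A \in unitmx by rewrite unitmxE unitfE.
rewrite -row_full_unit => /eqP e.
by apply: leq_trans (mxrankM_maxr Z A); rewrite e.
Qed.

Lemma pid_mx_det :
  \det ((pid_mx q : 'M[C]_(q, n)) *m (pid_mx q : 'M_(n, q))) = 1.
Proof. by rewrite mul_pid_mx minnn (minn_idPr (ltnW q_lt_n)) pid_mx_1 det1. Qed.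

Lemma rank_generic : exists2 w : {mpoly C[n * q]}, w != 0 &
  forall A, mxev w A != 0 -> \rank A = q.
Proof.
have [w wE] := minor_poly (pid_mx q); exists w => [|A]; last first.
  by rewrite wE; exact: det_mul_rank.
have : mxev w (pid_mx q) != 0 by rewrite wE pid_mx_det oner_eq0.
by apply: contraNneq => ->; rewrite /mxev meval0.
Qed.

Lemma mxev_full_inj (F G : {mpoly C[n * q]}) :
  (forall A, \rank A = q -> mxev F A = mxev G A) -> F = G.
Proof.
move=> e; have [w w0 rw] := rank_generic.
apply: (mpoly_eval_generic w0) => v; rewrite !mxev_pt => /rw; exact: e.
Qed.

(** The line argument is run from the single base point [pid_mx q]: the local fraction there is
    shown to be a polynomial F, and comparing F with the local fraction at any other A shows that F
    represents s everywhere. *)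
Lemma section_poly m s : is_section m s ->
  exists F, forall (x : cpoint X) A, \rank A = q -> val x = psi A -> s x = mxev F A.
Proof.
move=> sP; have [pull pullE] := param_pullback.
have [w w0 rw] := rank_generic.
pose loc (PQ : {mpoly C[n * q]} * {mpoly C[n * q]}) :=
  forall (x : cpoint X) A, \rank A = q -> val x = psi A -> mxev PQ.2 A != 0 ->
    s x = mxev PQ.1 A / mxev PQ.2 A.
have locP A : \rank A = q -> exists2 PQ, loc PQ & mxev PQ.2 A != 0.
  move=> rA; have [x xA] := param_cpoint rA.
  have [d [p [r [_ _ rx sE]]]] := sP x.
  exists (pull p, pull r) => /= [y B rB yB|]; last by rewrite pullE -xA.
  by rewrite !pullE -yB; exact: sE.
(* Any two local fractions agree where both denominators are nonzero and the rank is full, so they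
   agree as rational functions. *)
have locE PQ PQ' : loc PQ -> loc PQ' -> PQ.2 != 0 -> PQ'.2 != 0 ->
    PQ.1 * PQ'.2 = PQ'.1 * PQ.2.
  move=> h h' Q0 Q0'; apply: (@mpoly_eval_generic _ _ (w * (PQ.2 * PQ'.2))).
    by rewrite !mulf_neq0.
  move=> v; rewrite !mevalM !mulf_eq0 !negb_or !mxev_pt => /and3P[/rw rA QA QA'].
  have [x xA] := param_cpoint rA.
  have e : mxev PQ.1 (mxpt v) / mxev PQ.2 (mxpt v) =
      mxev PQ'.1 (mxpt v) / mxev PQ'.2 (mxpt v) by rewrite -(h x) // -(h' x).
  by apply/eqP; rewrite -eqr_div // e.
have nz (Q : {mpoly C[n * q]}) A : mxev Q A != 0 -> Q != 0.
  by apply: contraNneq => ->; rewrite /mxev meval0.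
have rA0 : \rank (pid_mx q : 'M[C]_(n, q)) = q.
  by apply: (@det_mul_rank (pid_mx q)); rewrite pid_mx_det oner_eq0.
have [PQ0 loc0 Q0A0] := locP _ rA0.
have [B|F PF] := @dvd_on_lines _ _ PQ0.1 PQ0.2 (krylov_poly C q_lt_n)
    (fun k => mxvec (pid_mx q) 0 k) Q0A0 (krylov_poly_neq0 C q_lt_n).
  rewrite mxev_pt mxev_krylov => KB.
  have lE Q t : (line0 Q (fun k => mxvec (pid_mx q) 0 k) B).[t] =
      mxev Q (pid_mx q + t *: mxpt B).
    rewrite horner_line mxev_pt; congr (mxev _ _).
    by apply/matrixP => i j; rewrite !mxE mxvecE mxE.
  apply: dvdp_local => [|t].
    apply: contraNneq Q0A0 => /(congr1 (fun p => p.[0])).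
    by rewrite lE scale0r addr0 horner0 => ->.
  (* The point at parameter t has full rank, so it carries a local fraction with nonzero
     denominator, which is the local condition of [dvdp_local]. *)
  have /eqP/locP[PQ1 loc1 Q1A] := krylov_line_rank t KB.
  exists (line0 PQ1.2 (fun k => mxvec (pid_mx q) 0 k) B).
  exists (line0 PQ1.1 (fun k => mxvec (pid_mx q) 0 k) B).
  by rewrite lE; split=> //; rewrite /line0 -!lineM (locE _ _ loc0 loc1 (nz _ _ Q0A0) (nz _ _ Q1A)).
exists F => x A rA xA; have [PQ1 loc1 Q1A] := locP _ rA.
rewrite (loc1 x A) //; apply: (mulIf Q1A); rewrite mulfVK // /mxev -!mevalM.
congr (_.@[_]); apply: (mulIf (nz _ _ Q0A0)).
by rewrite mulrAC [F * _]mulrC -PF -(locE _ _ loc0 loc1 (nz _ _ Q0A0) (nz _ _ Q1A)).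
Qed.

End Param.

(** * Semi-invariant polynomials *)

Lemma det_mx22 (R : comNzRingType) (M : 'M[R]_2) :
  \det M = M 0 0 * M 1 1 - M 0 1 * M 1 0.
Proof.
rewrite (expand_det_row _ 0) !big_ord_recl big_ord0 addr0 /cofactor /=.
rewrite !det_mx11 !mxE !addn0 expr0 mul1r expr1 mulN1r mulrN.
by congr (_ * _ - _ * _); congr (M _ _); exact/val_inj.
Qed.

Section Invariants.
Variables (C : numClosedFieldType) (n q : nat) (n_gt0 : (0 < n)%N) (q_gt0 : (0 < q)%N).
Implicit Types (F G : {mpoly C[n * q]}) (A B : 'M[C]_(n, q)) (t : 'rV[C]_n).

Definition inv_poly k F :=
  [/\ forall A c, c != 0 -> mxev F (c *: A) = c ^+ (n * q * k) * mxev F A,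
      forall A h, \det h = 1 -> mxev F (A *m h) = mxev F A
    & forall A t, \prod_i t 0 i = 1 -> mxev F (diag_mx t *m A) = mxev F A].

(** A q-th root c of [\det h] splits h into the scalar c and a matrix of determinant 1. *)
Lemma inv_poly_mulr k F A h : inv_poly k F -> \det h != 0 ->
  mxev F (A *m h) = \det h ^+ (n * k) * mxev F A.
Proof.
move=> [hc hh _] d0; pose c := q.-root (\det h).
have cq : c ^+ q = \det h by rewrite rootCK.
have c0 : c != 0 by rewrite rootC_eq0.
have -> : A *m h = c *: (A *m (c^-1 *: h)) by rewrite -scalemxAr scalerA mulfV // scale1r.
rewrite hc // hh; first by rewrite -cq -exprM mulnA [(n * q)%N]mulnC.
by rewrite detZ exprVn cq mulVf.
Qed.

(** An n-th root of the product of the t's plays the same role for the torus. *)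
Lemma inv_poly_diag k F A t : inv_poly k F -> (forall i, t 0 i != 0) ->
  mxev F (diag_mx t *m A) = (\prod_i t 0 i) ^+ (q * k) * mxev F A.
Proof.
move=> [hc _ ht] t0; pose c := n.-root (\prod_i t 0 i).
have cn : c ^+ n = \prod_i t 0 i by rewrite rootCK.
have c0 : c != 0 by rewrite rootC_eq0 //; apply/prodf_neq0 => i _; exact: t0.
have -> : diag_mx t *m A = c *: (diag_mx (c^-1 *: t) *m A).
  by rewrite linearZ /= -scalemxAl scalerA mulfV // scale1r.
rewrite hc // ht; first by rewrite -cn -exprM mulnA.
under eq_bigr do rewrite mxE.
by rewrite big_split /= prodr_const card_ord exprVn cn mulVf // -cn expf_neq0.
Qed.

Lemma poly_eq_generic (p r w : {poly C}) : w != 0 ->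
  (forall x, w.[x] != 0 -> p.[x] = r.[x]) -> p = r.
Proof.
move=> w0 e; apply/eqP; rewrite -subr_eq0; apply/eqP.
apply: (mulIf w0); rewrite mul0r.
apply: (roots_geq_poly_eq0 _ (uniq_natr C (size ((p - r) * w)))).
  apply/allP => x _; rewrite rootE hornerM hornerD hornerN mulf_eq0.
  have [_|/e ->] := eqVneq w.[x] 0; first by rewrite orbT.
  by rewrite subrr eqxx.
by rewrite size_map size_iota.
Qed.

(* Differentiating F (A + x B) = (1 + d x)^m F A at x = 0. *)
Lemma deriv_semi_inv F A B (d : C) m :
  (forall x, 1 + d * x != 0 -> mxev F (A + x *: B) = (1 + d * x) ^+ m * mxev F A) ->
  \sum_i \sum_j B i j * mxev F^`M(mxvec_index i j) A = d * m%:R * mxev F A.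
Proof.
move=> h; set v := fun k => mxvec A 0 k; set w := fun k => mxvec B 0 k.
have : line0 F v w = (1 + d *: 'X) ^+ m * (mxev F A)%:P.
  have hE x : (1 + d *: 'X).[x] = 1 + d * x.
    by rewrite hornerD hornerZ hornerX -[1]/(1%:P) hornerC.
  apply: (@poly_eq_generic _ _ (1 + d *: 'X)) => [|x].
    apply/eqP => /(congr1 (fun p => p.[0])) /eqP.
    by rewrite hE mulr0 addr0 horner0 oner_eq0.
  rewrite hE => /h; rewrite hornerM horner_exp hE hornerC => <-.
  rewrite horner_line; apply: meval_eq => k.
  by rewrite /v /w linearD linearZ !mxE.
move/(congr1 (fun p => p^`().[0])).
have coef1E (p : {poly C}) : p^`().[0] = p`_1 by rewrite horner_coef0 coef_deriv.
rewrite !coef1E line_coef1 sum_mxvec /v /w.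
under eq_bigr => i _ do under eq_bigr => j _ do rewrite mxvecE -/(mxev _ A).
move=> ->; rewrite coefMC -coef1E deriv_exp derivD derivZ derivX -[1]/(1%:P) derivC.
rewrite add0r hornerMn hornerM hornerZ horner_exp hornerD hornerZ hornerX !hornerC.
by rewrite mulr0 addr0 expr1n !mulr1 -mulr_natr.
Qed.

End Invariants.

(** The generators of degree one: a product of n minors is a form of degree n in the Plücker
    coordinates, hence comes from a section of the polarizing bundle. *)
Definition unit_poly (C : numClosedFieldType) n q (G : {mpoly C[n * q]}) :=
  [/\ exists Zs : seq 'M[C]_(q, n),
        size Zs = n /\ forall A, mxev G A = \prod_(Z <- Zs) \det (Z *m A)
    & forall A (t : 'rV_n), \prod_i t 0 i = 1 -> mxev G (diag_mx t *m A) = mxev G A].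

Definition unit_prod (C : numClosedFieldType) n q k (g : {mpoly C[n * q]}) :=
  exists Gs : seq {mpoly C[n * q]}, [/\ size Gs = k,
    {in Gs, forall G, unit_poly G} & g = \prod_(G <- Gs) G].

Lemma sum_delta (R : pzSemiRingType) (I : finType) (i : I) (F : I -> R) :
  \sum_j (j == i)%:R * F j = F i.
Proof.
rewrite (bigD1 i) //= eqxx mul1r big1 ?addr0 // => j /negbTE ->.
by rewrite mul0r.
Qed.

Section TwoVectors.
Variables (C : numClosedFieldType) (n : nat) (n_gt0 : (0 < n)%N).
Implicit Types (F : {mpoly C[n * 2]}) (A : 'M[C]_(n, 2)).

(** Differentiate along right multiplication by 1 + x E_ab, whose determinant is 1 + x on the
    diagonal and 1 off it. *)
Lemma inv_poly_sl2 k F : inv_poly k F -> sl2_semi_inv (n * k) F.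
Proof.
move=> hF a b; apply: mpoly_eval_inj => v; rewrite mevalZ /row_pol raddf_sum /=.
rewrite !mxev_pt; set A := mxpt v.
rewrite -(@deriv_semi_inv _ _ _ F A (A *m delta_mx a b)); last first.
  move=> x dx; have -> : A + x *: (A *m delta_mx a b) = A *m (1%:M + x *: delta_mx a b).
    by rewrite mulmxDr mulmx1 scalemxAr.
  have dE : \det (1%:M + x *: delta_mx a b : 'M[C]_2) = 1 + (a == b)%:R * x.
    rewrite det_mx22 !mxE; have [->|->] := ord2_cases a; have [->|->] := ord2_cases b => /=; ring.
  by rewrite (inv_poly_mulr (isT : (0 < 2)%N) _ hF) // dE.
apply: eq_bigr => j _; rewrite mevalM mevalXU mxev_pt -/A.
rewrite (bigD1 b) //= big1 ?addr0 => [|c cb].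
  rewrite mxE (bigD1 a) //= big1 ?addr0 => [|c ca].
    by rewrite [delta_mx _ _ _ _]mxE !eqxx mulr1 mxE.
  by rewrite [delta_mx _ _ _ _]mxE (negbTE ca) mulr0.
rewrite mxE big1 ?mul0r // => d _.
by rewrite [delta_mx _ _ _ _]mxE (negbTE cb) andbF mulr0.
Qed.

(** Differentiate along the scaling of row l by 1 + x. *)
Lemma inv_poly_row_deg k F l : inv_poly k F -> row_deg l F = k.*2%:R *: F.
Proof.
move=> hF; apply: mpoly_eval_inj => v; rewrite mevalZ /row_deg raddf_sum /=.
rewrite !mxev_pt; set A := mxpt v; rewrite -mul2n -[(2 * k)%:R]mul1r.
rewrite -(@deriv_semi_inv _ _ _ F A (delta_mx l l *m A)); last first.
  move=> x; rewrite mul1r => x1; pose t : 'rV[C]_n := \row_i (if i == l then 1 + x else 1).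
  have -> : A + x *: (delta_mx l l *m A) = diag_mx t *m A.
    clearbody A; rewrite mul_diag_mx; apply/matrixP => i j; rewrite !mxE.
    under eq_bigr do rewrite mxE andbC -mulnb natrM -mulrA.
    by rewrite sum_delta; have [->|_] := eqVneq i l => /=; ring.
  rewrite (inv_poly_diag n_gt0 _ hF) // => [|i]; last first.
    by rewrite mxE; case: ifP => // _; exact: oner_neq0.
  congr (_ ^+ _ * _); rewrite (bigD1 l) //= mxE eqxx big1 ?mulr1 // => i il.
  by rewrite mxE (negbTE il).
rewrite (bigD1 l) //= [X in _ + X]big1 ?addr0 => [|i il].
  apply: eq_bigr => a _; rewrite mevalM mevalXU mxev_pt -/A; congr (_ * _).
  rewrite !mxE; under eq_bigr do rewrite mxE eqxx /=.
  by rewrite sum_delta mxE.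
apply: big1 => j _; rewrite mxE big1 ?mul0r // => d _.
by rewrite mxE (negbTE il) mul0r.
Qed.

Lemma mxev_bracket i j A : mxev (bracket C i j) A = A i 0 * A j 1 - A i 1 * A j 0.
Proof. by rewrite /mxev mevalB !mevalM !mevalXU !mxvecE. Qed.

Lemma bracket_minor i j A :
  mxev (bracket C i j) A =
  \det ((\matrix_(a < 2, k < n) (k == if a == 0 then i else j)%:R) *m A).
Proof.
have h a b : ((\matrix_(a < 2, k < n) (k == if a == 0 then i else j)%:R) *m A) a b =
    A (if a == 0 then i else j) b.
  by rewrite mxE; under eq_bigr do rewrite mxE; rewrite sum_delta.
by rewrite det_mx22 !h mxev_bracket.
Qed.

(** Every vertex is met exactly twice, so the diagonal matrix t multiplies the product by the square
    of the product of its entries, which is 1. *)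
Lemma two_factor_unit (e : seq ('I_n * 'I_n)) :
  size e = n -> (forall v, edge_deg e v = 2) ->
  unit_poly (\prod_(u <- e) bracket C u.1 u.2).
Proof.
have mxev_prod A : mxev (\prod_(u <- e) bracket C u.1 u.2) A =
    \prod_(u <- e) mxev (bracket C u.1 u.2) A by exact: rmorph_prod.
move=> se de; split=> [|A t t1].
  exists [seq (\matrix_(a < 2, k < n) (k == if a == 0 then u.1 else u.2)%:R) | u <- e].
  rewrite size_map; split=> // A; rewrite mxev_prod big_map.
  by apply: eq_bigr => u _; exact: bracket_minor.
rewrite !mxev_prod (eq_bigr (fun u => (t 0 u.1 * t 0 u.2) * mxev (bracket C u.1 u.2) A)).
  rewrite big_split /= [X in X * _](_ : _ = 1) ?mul1r // big_split /=.
  have cnt (P : 'I_n * 'I_n -> 'I_n) :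
      \prod_(u <- e) t 0 (P u) = \prod_v t 0 v ^+ count (fun u => P u == v) e.
    elim: e {mxev_prod se de} => [|u e IH] /=; first by rewrite big_nil big1.
    rewrite big_cons IH [in RHS](eq_bigr (fun v => t 0 v ^+ (P u == v) *
      t 0 v ^+ count (fun u => P u == v) e)) => [|v _]; last exact: exprD.
    rewrite big_split; congr (_ * _) => /=.
    rewrite (bigD1 (P u)) //= eqxx expr1 big1 ?mulr1 // => v.
    by rewrite eq_sym => /negbTE ->; rewrite expr0.
  rewrite (cnt fst) (cnt snd) -big_split /= (eq_bigr (fun v => t 0 v ^+ 2)).
    by rewrite prodrXl t1 expr1n.
  by move=> v _; rewrite -exprD; congr (_ ^+ _); exact: de.
move=> u _; rewrite !mxev_bracket mul_diag_mx !mxE; ring.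
Qed.

Lemma bracket_unor (e : seq ('I_n * 'I_n)) : exists b : bool,
  \prod_(u <- e) bracket C u.1 u.2 =
  (-1) ^+ b * \prod_(u <- map (@unor n) e) bracket C u.1 u.2.
Proof.
elim: e => [|u e [b IH]]; first by exists false; rewrite !big_nil mulr1.
rewrite map_cons !big_cons IH /unor; case: ifP => _; first by exists b; rewrite mulrCA.
exists (~~ b); rewrite signrN mulrCA mulNr -mulrN -mulNr; congr (_ * (_ * _)).
by rewrite /bracket opprB [in RHS]mulrC [X in _ - X = _]mulrC.
Qed.

Lemma inv_poly_units2 k F : inv_poly k F -> lincomb (unit_prod k) F.
Proof.
move=> hF; apply: lincomb_trans (sl2_semi_inv_brackets (inv_poly_sl2 hF)
  (fun l => inv_poly_row_deg l hF)) => g [e [_ de ->]].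
have [v|E [sE hE pE]] := @petersen_two_factors n k e.
  (* Degrees were known only as elements of C; characteristic zero returns them as natural
     numbers. *)
  by apply/eqP; rewrite -(eqr_nat C) de.
have [b ->] := bracket_unor e; have [b' e2] := bracket_unor (flatten E).
have -> : \prod_(u <- map (@unor n) e) bracket C u.1 u.2 =
    (-1) ^+ b' * \prod_(u <- flatten E) bracket C u.1 u.2.
  by rewrite e2 mulrA -signr_addb addbb mul1r; exact: perm_big.
rewrite mulrA -signr_addb -(rmorph_sign (@mpolyC (n * 2) C)) mul_mpolyC; apply/lincombZ/lincomb1.
exists [seq \prod_(u <- e') bracket C u.1 u.2 | e' <- E]; split.
- by rewrite size_map.
- by move=> G /mapP[e' /hE[se de'] ->]; exact: two_factor_unit.
- by rewrite big_map big_flatten.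
Qed.

End TwoVectors.

(** Vectors with nonzero entries form one orbit of the invertible diagonal matrices, so F is
    determined by its value at the all-ones vector J. *)
Lemma inv_poly_units1 (C : numClosedFieldType) n k (F : {mpoly C[n * 1]}) :
  (0 < n)%N -> inv_poly k F -> lincomb (unit_prod k) F.
Proof.
move=> n0 hF; pose G : {mpoly C[n * 1]} := \prod_i 'X_(mxvec_index i 0).
have GE A : mxev G A = \prod_i A i 0.
  by rewrite /mxev rmorph_prod; apply: eq_bigr => i _ /=; rewrite mevalXU mxvecE.
pose J : 'cV[C]_n := const_mx 1.
have -> : F = mxev F J *: G ^+ k.
  apply: (@mpoly_eval_generic _ _ G) => [|v].
    by apply/prodf_neq0 => i _; rewrite -msupp_eq0 msuppX.
  rewrite !mxev_pt GE => /prodf_neq0 v0; set A := mxpt v.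
  have {1}-> : A = diag_mx (A^T) *m J.
    by rewrite mul_diag_mx; apply/matrixP => i j; rewrite !mxE mulr1 ord1.
  rewrite (inv_poly_diag n0 _ hF) // => [|i]; last by rewrite mxE v0.
  rewrite mul1n mulrC /mxev mevalZ rmorphXn; congr (_ * _ ^+ _).
  by rewrite -[RHS]/(mxev G A) GE; apply: eq_bigr => i _; rewrite mxE.
apply/lincombZ/lincomb1; exists (nseq k G); split; first exact: size_nseq.
  move=> g /nseqP[-> _]; split=> [|A t t1]; last first.
    rewrite !GE (eq_bigr (fun i => t 0 i * A i 0)) => [|i _]; last by rewrite mul_diag_mx mxE.
    by rewrite big_split /= t1 mul1r.
  exists [seq delta_mx 0 i | i <- enum 'I_n]; rewrite size_map size_enum_ord.
  split=> // A; rewrite GE big_map big_enum; apply: eq_bigr => i _ /=.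
  rewrite det_mx11 mxE; under eq_bigr do rewrite mxE /=.
  by rewrite sum_delta.
by rewrite big_nseq -Monoid.iteropE.
Qed.

(** * Generation in degree one *)

Lemma meval_dhomog (R : comNzRingType) m d (p : {mpoly R[m]}) c v :
  p \is d.-homog -> p.@[fun i => c * v i] = c ^+ d * p.@[v].
Proof.
move=> /dhomogP hp; rewrite !mevalE mulr_sumr !big_seq; apply: eq_bigr => u /hp ud.
rewrite mulrCA; congr (_ * _).
rewrite (eq_bigr (fun i => c ^+ u i * v i ^+ u i)) => [|i _]; last exact: exprMn.
by rewrite big_split /= -expr_sum -mdegE ud.
Qed.

Lemma mxev_comp_mul (R : comNzRingType) n q (F : {mpoly R[n * q]}) (M : 'M_n) (h : 'M_q) :
  exists G : {mpoly R[n * q]}, forall A, mxev G A = mxev F (M *m A *m h).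
Proof.
pose e i j := \sum_k \sum_l (M i l * h k j) *: ('X_(mxvec_index l k) : {mpoly R[n * q]}).
exists (F \mPo [tuple mxvec (\matrix_(i, j) e i j) 0 k | k < n * q]) => A.
rewrite /mxev comp_mpoly_meval; apply: meval_eq => k; rewrite tnth_mktuple.
case/mxvec_indexP: k => i j; rewrite !mxvecE !mxE /e raddf_sum; apply: eq_bigr => k _ /=.
rewrite mxE mulr_suml raddf_sum; apply: eq_bigr => l _ /=.
by rewrite mevalZ mevalXU mxvecE; ring.
Qed.

Lemma mxrank_unitl (F : fieldType) n q (M : 'M[F]_n) (A : 'M_(n, q)) :
  M \in unitmx -> \rank (M *m A) = \rank A.
Proof.
by move=> uM; rewrite -mxrank_tr trmx_mul mxrankMfree ?mxrank_tr // row_free_unit unitmx_tr.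
Qed.

(** Both directions are needed: the first makes the polynomial of an invariant section
    torus-invariant, the second makes the section of a torus-invariant polynomial H-invariant. Only
    full-rank matrices represent points of the cone. *)
Definition param_action (C : numClosedFieldType) n q N
    (psi : 'M[C]_(n, q) -> 'cV[C]_N) (H : set 'M[C]_N) : Prop :=
  (forall t : 'rV_n, \prod_i t 0 i = 1 -> exists2 h, H h &
     forall A, \rank A = q -> h *m psi A = psi (diag_mx t *m A)) /\
  (forall h, H h -> exists2 t : 'rV_n, \prod_i t 0 i = 1 &
     forall A, \rank A = q -> h *m psi A = psi (diag_mx t *m A)).

Section Sections.
Variables (C : numClosedFieldType) (n q N : nat) (q_gt0 : (0 < q)%N) (q_lt_n : (q < n)%N).
Variables (X : @cone C N) (psi : 'M[C]_(n, q) -> 'cV[C]_N) (H : set 'M[C]_N).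
Hypothesis psiP : minors_param X psi.
Hypothesis actP : param_action psi H.
Implicit Types (x y : cpoint X) (A : 'M[C]_(n, q)) (s : cpoint X -> C).

Definition represents (F : {mpoly C[n * q]}) s :=
  forall x A, \rank A = q -> val x = psi A -> s x = mxev F A.

(** A homogeneous denominator nonzero at x is nonzero at c x, so one local fraction computes s at
    both points. *)
Lemma section_scale m s x y c : is_section m s -> c != 0 ->
  val y = c *: val x -> s y = c ^+ m * s x.
Proof.
move=> sP c0 yx; have [d [p [r [hp hr rx sE]]]] := sP x.
have pevE k (p' : {mpoly C[N]}) : p' \is k.-homog -> pev p' y = c ^+ k * pev p' x.
  move=> h; rewrite /pev -(meval_dhomog _ _ h); apply: meval_eq => i.
  by rewrite yx mxE.
have ry : pev r y != 0 by rewrite (pevE _ _ hr) mulf_neq0 ?expf_neq0.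
rewrite !sE // (pevE _ _ hp) (pevE _ _ hr) exprD.
rewrite -[_ * _ * pev p x]mulrA -mulf_div mulfV ?expf_neq0 //.
by rewrite mul1r mulrA.
Qed.

Lemma inv_section_poly k s : is_invariant_section H (n * k) s ->
  exists2 F, inv_poly k F & represents F s.
Proof.
move=> [sP sH]; have [F FE] := section_poly q_lt_n psiP sP.
(* The cone only controls matrices of full rank; as both sides are polynomials in A, such identities
   extend to all matrices. *)
have ext (M : 'M_n) (h : 'M_q) c :
    (forall A, \rank A = q -> mxev F (M *m A *m h) = c * mxev F A) ->
    forall A, mxev F (M *m A *m h) = c * mxev F A.
  move=> e A; have [G GE] := mxev_comp_mul F M h.
  rewrite -GE /mxev -mevalZ; congr (_.@[_]).
  apply: (mxev_full_inj q_lt_n psiP) => B rB.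
  by rewrite GE e // /mxev mevalZ.
have mulh A h : \rank A = q -> \det h != 0 ->
    mxev F (A *m h) = \det h ^+ (n * k) * mxev F A.
  move=> rA h0; have rAh : \rank (A *m h) = q.
    by rewrite mxrankMfree // row_free_unit unitmxE unitfE.
  have [x xA] := param_cpoint psiP rA; have [y yA] := param_cpoint psiP rAh.
  rewrite -(FE _ _ rAh yA) -(FE _ _ rA xA); apply: section_scale sP h0 _.
  by rewrite yA xA (param_mulr psiP).
exists F; last exact: FE; split.
- move=> A c c0; rewrite -[c *: A]mul1mx -[A in c *: A]mulmx1 scalemxAr mulmxA.
  rewrite scalemx1; apply: ext => B rB; rewrite mul1mx mulh ?det_scalar ?expf_neq0 //.
  by rewrite -exprM mulnA [(q * n)%N]mulnC.
- move=> A h h1; rewrite -[A *m h]mul1mx mulmxA -[RHS]mul1r; apply: ext => B rB.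
  by rewrite mul1mx mulh ?h1 ?oner_neq0 // expr1n.
- move=> A t t1; rewrite -[_ *m A]mulmx1 -[RHS]mul1r; apply: ext => B rB.
  have ut : diag_mx t \in unitmx by rewrite unitmxE det_diag t1 unitr1.
  have rtB : \rank (diag_mx t *m B) = q by rewrite mxrank_unitl.
  have [x xA] := param_cpoint psiP rB; have [y yA] := param_cpoint psiP rtB.
  rewrite mulmx1 mul1r -(FE _ _ rtB yA) -(FE _ _ rB xA).
  have [h Hh hE] := actP.1 t t1.
  by apply: (sH h Hh); rewrite xA yA hE.
Qed.

Lemma unit_section G : unit_poly G ->
  exists2 s, is_invariant_section H n s & represents G s.
Proof.
move=> [[Zs [sZ GE]] Gt].
pose u Z := projT1 (cid (param_minor psiP Z)).
have uE Z A : \det (Z *m A) = (u Z *m psi A) 0 0.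
  by rewrite (projT2 (cid (param_minor psiP Z))).
pose p : {mpoly C[N]} := \prod_(Z <- Zs) \sum_k u Z 0 k *: 'X_k.
have pE x A : val x = psi A -> pev p x = mxev G A.
  move=> xA; rewrite GE /pev rmorph_prod; apply: eq_bigr => Z _ /=.
  rewrite uE mxE raddf_sum; apply: eq_bigr => k _ /=.
  by rewrite mevalZ mevalXU xA.
exists (pev p); last by move=> x A _; exact: pE.
split=> [x|h Hh x y yx].
  exists 0%N, p, 1; split.
  - rewrite add0n -sZ /p; elim: (Zs) => [|Z r IH]; first by rewrite big_nil dhomog1.
    rewrite big_cons -[size _]add1n; apply: dhomogM => //.
    by apply: rpred_sum => k _; apply: rpredZ; rewrite dhomogX /= mdeg1.
  - exact: dhomog1.
  - by rewrite /pev meval1 oner_neq0.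
  - by move=> y _; rewrite [pev 1 y]meval1 divr1.
have [A [rA xA]] := cpoint_param psiP x; have [t t1 hE] := actP.2 h Hh.
by rewrite (pE x A xA) (pE y (diag_mx t *m A)) ?Gt // yx xA hE.
Qed.

Hypothesis inv_poly_units : forall k (F : {mpoly C[n * q]}), inv_poly k F -> lincomb (unit_prod k) F.

Lemma represents_inj F s s' : represents F s -> represents F s' -> s = s'.
Proof.
move=> h h'; apply/funext => x; have [A [rA xA]] := cpoint_param psiP x.
by rewrite (h x A) // (h' x A).
Qed.

(** S ranges over predicates on the ambient polynomials and not on [git_ring], so that it can be a
    subalgebra, giving generation, or the ring itself, showing that every invariant polynomial comes
    from the ring. *)
Lemma generated_subset (S : {poly (cpoint X -> C)} -> Prop) :
  (forall P Q, S P -> S Q -> S (P + Q)) -> (forall P Q, S P -> S Q -> S (P * Q)) ->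
  (forall c : C, S (fun=> c)%:P) ->
  (forall s, is_invariant_section H n s -> S (s%:P * 'X)) ->
  forall k F, inv_poly k F -> exists2 s, represents F s & S (s%:P * 'X^k).
Proof.
move=> SD SM SC S1 k F /inv_poly_units[r [hr ->]].
have units Gs : {in Gs, forall G : {mpoly C[n * q]}, unit_poly G} ->
    exists2 s, represents (\prod_(G <- Gs) G) s & S (s%:P * 'X^(size Gs)).
  elim: Gs => [_|G Gs IH hG].
    exists (fun=> 1); first by move=> x A _ _; rewrite big_nil /mxev meval1.
    by rewrite expr0 mulr1.
  have [|s rs Ss] := IH; first by move=> G' h; apply: hG; rewrite inE h orbT.
  have [t tH rt] := unit_section (hG G (mem_head _ _)).
  exists (t * s).
    move=> x A rA xA; by rewrite big_cons -[LHS]/(t x * s x) (rt x A) // (rs x A) // /mxev mevalM.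
  rewrite /= exprS polyCM mulrACA; apply: SM => //; exact: S1.
elim: r hr => [_|c r IH hr].
  exists (fun=> 0); first by move=> x A _ _; rewrite big_nil /mxev meval0.
  rewrite -[X in S (X%:P * _)]/(0 : cpoint X -> C) polyC0 mul0r.
  exact: (SC 0).
rewrite big_cons; have [|s rs Ss] := IH; first by move=> c' h; apply: hr; rewrite inE h orbT.
have [Gs [sGs hGs cE]] := hr c (mem_head _ _).
have [t rt St] := units _ hGs.
exists ((fun=> c.1) * t + s).
  move=> x A rA xA; rewrite -[LHS]/(c.1 * t x + s x) (rt x A) // (rs x A) //.
  by rewrite /mxev mevalD mevalZ cE.
rewrite polyCD polyCM mulrDl -mulrA; apply: (SD _ _ _ Ss); apply: SM (SC _) _.
by rewrite -sGs.
Qed.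

Lemma git_ring_const (c : C) : (fun=> c)%:P \in @git_ring_pred C N X H n.
Proof.
apply/asboolP => k; rewrite coefC; case: k => [|k] /=; last exact: invariant_section0.
rewrite muln0; split=> // x; exists 0%N, c%:MP, 1; split.
- by rewrite -[c%:MP]mulr1 mul_mpolyC; apply: rpredZ; exact: dhomog1.
- exact: dhomog1.
- by rewrite /pev meval1 oner_neq0.
- by move=> y _; rewrite /pev meval1 mevalC divr1.
Qed.

Lemma git_ring_deg1 s :
  is_invariant_section H n s -> s%:P * 'X \in @git_ring_pred C N X H n.
Proof.
move=> sP; apply/asboolP => k; rewrite coefCM coefX; case: eqP => [->|_].
  by rewrite mulr1 muln1.
by rewrite mulr0; exact: invariant_section0.
Qed.

Lemma git_generated : generated_in_degree1 X H n.
Proof.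
move=> S Sring Sscal S1 a.
have [S_1 S_B S_M] := Sring.
have SN b : b \in S -> - b \in S.
  by move=> bS; rewrite -sub0r; apply: (S_B _ _) => //; rewrite -(subrr 1); exact: S_B.
pose Sp P := exists2 b : git_ring X H n, b \in S & git_poly b = P.
have SpD P Q : Sp P -> Sp Q -> Sp (P + Q).
  move=> [b bS <-] [c cS <-]; exists (b + c) => //.
  by rewrite -[c]opprK; apply: (S_B _ _) => //; exact: SN.
have SpM P Q : Sp P -> Sp Q -> Sp (P * Q).
  by move=> [b bS <-] [c cS <-]; exists (b * c) => //; exact: S_M.
have SpC (c : C) : Sp (fun=> c)%:P.
  by exists (GitRing (git_ring_const c)) => //; apply: (Sscal c).
have Sp1 s : is_invariant_section H n s -> Sp (s%:P * 'X).
  move=> sP; exists (GitRing (git_ring_deg1 sP)) => //; apply: S1 => j /negbTE j1.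
  by rewrite /= coefCM coefX j1 mulr0.
suff [b bS /val_inj <-] : Sp (git_poly a) by [].
rewrite -[git_poly a]coefK poly_def.
elim/big_ind: _ => [||k _]; [exact: (SpC 0) | exact: SpD |].
have /asboolP/(_ k)/inv_section_poly[F Fk rF] := git_polyP a.
have [s rs Ss] := generated_subset SpD SpM SpC Sp1 Fk.
by rewrite -mul_polyC (represents_inj rF rs).
Qed.

End Sections.

(** * Integral closedness *)

(** X^N - 1 is separable in characteristic zero; a field containing its N distinct roots contains
    one of exact order N. *)
Lemma prim_root_closed (C : numClosedFieldType) N : (0 < N)%N ->
  exists z : C, N.-primitive_root z.
Proof.
move=> N0; pose p : {poly C} := 'X^N - 1.
have [r pE] := closed_field_poly_normal p.
have mp : p \is monic by rewrite monicXnsubC.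
rewrite (monicP mp) scale1r in pE.
have sr : size r = N.
  by have := size_XnsubC (1 : C) N0; rewrite -/p pE size_prod_XsubC => -[].
have ur : uniq r.
  rewrite -separable_prod_XsubC -pE; apply: separable_Xn_sub_1.
  by rewrite pnatr_eq0 -lt0n.
have : has N.-primitive_root r.
  apply: has_prim_root => //; last by rewrite sr.
  apply/allP => z zr; apply/unity_rootP/eqP.
  have : root p z by rewrite pE root_prod_XsubC.
  by rewrite rootE /p !hornerE subr_eq0.
by case/hasP => z _ hz; exists z.
Qed.

(** The rational root argument: in lowest terms the denominator divides a power of the numerator, so
    it is constant. The equation is homogenized to stay free of fractions. *)
Lemma dvdp_integral (F : fieldType) (a b : {poly F}) d (c : 'I_d -> {poly F}) :
  b != 0 -> a ^+ d + \sum_i c i * a ^+ i * b ^+ (d - i) = 0 -> b %| a.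
Proof.
move=> b0 h; pose g := gcdp a b.
have g0 : g != 0 by rewrite gcdp_eq0 negb_and b0 orbT.
have /dvdpP[a' aE] : g %| a by exact: dvdp_gcdl.
have /dvdpP[b' bE] : g %| b by exact: dvdp_gcdr.
have cop : coprimep a' b'.
  have : coprimep (a %/ g) (b %/ g) by apply: coprimep_div_gcd; rewrite b0 orbT.
  by rewrite aE bE !mulpK.
suff b'1 : size b' == 1%N.
  have /size_poly1P[e e0 b'E] := b'1.
  by rewrite bE aE b'E mul_polyC dvdpZl // dvdp_mull.
have : a' ^+ d + \sum_i c i * a' ^+ i * b' ^+ (d - i) = 0.
  apply: (mulIf (expf_neq0 d g0)); rewrite mul0r -[RHS]h mulrDl -exprMn -aE; congr (_ + _).
  rewrite mulr_suml; apply: eq_bigr => i _.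
  have -> : g ^+ d = g ^+ i * g ^+ (d - i) by rewrite -exprD subnKC // ltnW.
  rewrite aE bE !exprMn; ring.
move/eqP; rewrite addr_eq0 => /eqP e.
have : b' %| a' ^+ d.
  rewrite e dvdpNr; apply: (big_ind (fun p => b' %| p)) => [||i _].
  - exact: dvdp0.
  - by move=> x y; exact: dvdp_add.
  by rewrite -(subnSK (ltn_ord i)) exprS dvdp_mull // dvdp_mulr.
move=> h'; rewrite -coprimepp; apply: coprimep_dvdl h' _.
by apply: coprimep_expr; rewrite coprimep_sym.
Qed.

Section IntegrallyClosed.
Variables (C : numClosedFieldType) (n q N : nat) (q_gt0 : (0 < q)%N) (q_lt_n : (q < n)%N).
Variables (X : @cone C N) (psi : 'M[C]_(n, q) -> 'cV[C]_N) (H : set 'M[C]_N).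
Hypothesis psiP : minors_param X psi.
Hypothesis actP : param_action psi H.
Hypothesis inv_poly_units :
  forall k (F : {mpoly C[n * q]}), inv_poly k F -> lincomb (unit_prod k) F.
Implicit Types (x y : cpoint X) (A : 'M[C]_(n, q)) (s : cpoint X -> C).
Implicit Types (F G : {mpoly C[n * q]}) (a b : git_ring X H n).

Local Notation repr := (represents psi).

(* The last condition forces all degrees to be multiples of n * q. *)
Definition sym_poly F :=
  [/\ forall A h, \det h = 1 -> mxev F (A *m h) = mxev F A,
      forall A (t : 'rV_n), \prod_i t 0 i = 1 -> mxev F (diag_mx t *m A) = mxev F A
    & forall A z, z ^+ (n * q) = 1 -> mxev F (z *: A) = mxev F A].

Lemma reprD F G s t : repr F s -> repr G t -> repr (F + G) (s + t).
Proof.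
move=> h h' x A rA xA; rewrite -[LHS]/(s x + t x) (h x A) // (h' x A) //.
by rewrite /mxev mevalD.
Qed.

Lemma reprM F G s t : repr F s -> repr G t -> repr (F * G) (s * t).
Proof.
move=> h h' x A rA xA; rewrite -[LHS]/(s x * t x) (h x A) // (h' x A) //.
by rewrite /mxev mevalM.
Qed.

Lemma repr0 : repr 0 (0 : cpoint X -> C).
Proof. by move=> x A _ _; rewrite /mxev meval0. Qed.

Lemma repr1 : repr 1 (1 : cpoint X -> C).
Proof. by move=> x A _ _; rewrite /mxev meval1. Qed.

Lemma repr_uniq F G s : repr F s -> repr G s -> F = G.
Proof.
move=> h h'; apply: (mxev_full_inj q_lt_n psiP) => A rA.
by have [x xA] := param_cpoint psiP rA; rewrite -(h x) // (h' x A).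
Qed.

(** Setting the grading variable to 1 replaces a graded family by a single function on the cone,
    hence by a single polynomial in A. *)
Definition total a : cpoint X -> C := (git_poly a).[1].

Lemma inv_poly_sym k F : inv_poly k F -> sym_poly F.
Proof.
move=> [h1 h2 h3]; split=> // A z z1; rewrite h1 ?(exprM z (n * q)) ?z1 ?expr1n ?mul1r //.
have nq : (0 < n * q)%N by rewrite muln_gt0 q_gt0 (leq_ltn_trans _ q_lt_n).
by apply/eqP => z0; move/eqP: z1; rewrite z0 expr0n eqn0Ngt nq eq_sym oner_eq0.
Qed.

Lemma total_repr a : exists2 F, repr F (total a) & sym_poly F.
Proof.
rewrite /total horner_coef.
elim/big_ind: _ => [|s t [F Fs [F1 F2 F3]] [G Gt [G1 G2 G3]]|k _].
- by exists 0; [exact: repr0 | split=> *; rewrite /mxev !meval0].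
- exists (F + G); first exact: reprD.
  split=> *; rewrite /mxev !mevalD -!/(mxev _ _); congr (_ + _);
  by [exact: F1|exact: G1|exact: F2|exact: G2|exact: F3|exact: G3].
rewrite expr1n mulr1.
have /asboolP/(_ k)/(inv_section_poly q_lt_n psiP actP)[F Fk rF] := git_polyP a.
by exists F => //; exact: inv_poly_sym Fk.
Qed.

(* The grading is recovered from the sum of the components, since the
   component of degree k scales by c ^ (n * k) on the cone. *)
Lemma total_inj a : repr 0 (total a) -> a = 0.
Proof.
move=> a0; apply: val_inj; apply/polyP => k; rewrite coef0; apply/funext => x /=.
have n0 : (0 < n)%N by exact: leq_ltn_trans q_lt_n.
have [A [rA xA]] := cpoint_param psiP x.
pose p : {poly C} := \poly_(k < size (git_poly a)) ((git_poly a)`_k x).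
suff p0 : p = 0.
  have := congr1 (fun p : {poly C} => p`_k) p0; rewrite coef0 coef_poly.
  by case: ltnP => // /(nth_default 0) -> _.
apply: (@poly_eq_generic _ _ _ 'X) => [|c]; first by rewrite polyX_eq0.
rewrite hornerX horner0 => c0; pose d := n.-root c; pose e := q.-root d.
have dn : d ^+ n = c by rewrite rootCK.
have eq' : e ^+ q = d by rewrite rootCK.
have d0 : d != 0 by rewrite rootC_eq0.
have e0 : e != 0 by rewrite rootC_eq0.
have rAe : \rank (A *m e%:M) = q.
  by rewrite mxrankMfree // row_free_unit unitmxE unitfE det_scalar eq'.
have [y yA] := param_cpoint psiP rAe.
have := a0 y _ rAe yA; rewrite /mxev meval0 /total horner_coef => <-.
rewrite fct_sumE horner_poly; apply: eq_bigr => i _.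
rewrite expr1n mulr1 -dn -exprM mulrC.
have /asboolP/(_ i)[sP _] := git_polyP a.
rewrite (section_scale (x := x) (y := y) sP d0) //.
by rewrite yA (param_mulr psiP) det_scalar eq' xA.
Qed.

Lemma prod_repr F k : inv_poly k F -> exists a, repr F (total a).
Proof.
move=> Fk; pose S P := P \in @git_ring_pred C N X H n.
have [|||s sP|s rs Ss] := @generated_subset _ _ _ _ _ _ _ psiP actP inv_poly_units S _ _ _ _ k F Fk.
- by move=> P Q hP hQ; exact: rpredD.
- by move=> P Q hP hQ; exact: rpredM.
- exact: git_ring_const.
- exact: git_ring_deg1.
exists (GitRing Ss); rewrite /total /= hornerM hornerC hornerXn expr1n mulr1.
exact: rs.
Qed.

Lemma sum_pihomog F : F = \sum_(d < msize F) pihomog mdeg d F.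
Proof. exact: pihomog_partitionE. Qed.

Lemma mxev_pihomog_scale F c A :
  mxev F (c *: A) = \sum_(d < msize F) c ^+ d * mxev (pihomog mdeg d F) A.
Proof.
rewrite {1}(sum_pihomog F) /mxev raddf_sum; apply: eq_bigr => d _ /=.
rewrite -(meval_dhomog _ _ (pihomogP _ _ _)); apply: meval_eq => k.
by rewrite linearZ mxE.
Qed.

(** Both group actions commute with scaling A by c; comparing coefficients of powers of c gives
    invariance of each homogeneous component. *)
Lemma sym_poly_pihomog F d : sym_poly F ->
  (forall A h, \det h = 1 -> mxev (pihomog mdeg d F) (A *m h) = mxev (pihomog mdeg d F) A) /\
  (forall A (t : 'rV_n), \prod_i t 0 i = 1 ->
    mxev (pihomog mdeg d F) (diag_mx t *m A) = mxev (pihomog mdeg d F) A).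
Proof.
move=> [h1 h2 _].
have key A A' : (forall c, mxev F (c *: A') = mxev F (c *: A)) ->
    mxev (pihomog mdeg d F) A' = mxev (pihomog mdeg d F) A.
  move=> h; have [dF|dF] := ltnP d (msize F); last first.
    suff -> : pihomog mdeg d F = 0 by rewrite /mxev !meval0.
    rewrite pihomogE big_seq_cond big_pred0 // => m; apply/negP => /andP[mF /eqP md].
    by have := msize_mdeg_lt mF; rewrite md ltnNge dF.
  pose p B : {poly C} := \poly_(d < msize F) mxev (pihomog mdeg d F) B.
  have : p A' = p A.
    apply: (@poly_eq_generic _ _ _ 1) => [|c _]; first exact: oner_neq0.
    rewrite !horner_poly; have := h c; rewrite !mxev_pihomog_scale.
    by under eq_bigr do rewrite mulrC; under [in X in _ = X -> _]eq_bigr do rewrite mulrC.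
  by move/(congr1 (fun p : {poly C} => p`_d)); rewrite !coef_poly dF.
split=> [A h dh|A t dt]; apply: key => c; first by rewrite scalemxAl h1.
by rewrite scalemxAr h2.
Qed.

(** A component of degree n q k is an invariant of degree k. In any other degree d, a primitive root
    z of order n q gives z^d different from 1, so the component vanishes. *)
Lemma sym_repr F : sym_poly F -> exists a, repr F (total a).
Proof.
move=> hF; have [h1 h2 h3] := hF.
rewrite (sum_pihomog F).
elim/big_ind: _ => [|G G' [a ra] [b rb]|d _].
- by exists 0; rewrite /total /= horner0; exact: repr0.
- by exists (a + b); rewrite /total /= hornerD; exact: reprD.
have nq : (0 < n * q)%N by rewrite muln_gt0 q_gt0 (leq_ltn_trans _ q_lt_n).
have [/dvdnP[k dk]|nd] := boolP (n * q %| d)%N.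
  apply: (@prod_repr _ k); have [e1 e2] := sym_poly_pihomog d hF; split=> // A c _.
  have -> : (n * q * k)%N = d by rewrite dk mulnC.
  rewrite -(meval_dhomog _ _ (pihomogP _ _ _)); apply: meval_eq => i.
  by rewrite linearZ mxE.
suff -> : pihomog mdeg d F = 0 by exists 0; rewrite /total /= horner0; exact: repr0.
have [z zP] := prim_root_closed C nq.
have e : F = \sum_(d < msize F) z ^+ d *: pihomog mdeg d F.
  apply: mpoly_eval_inj => v; rewrite !mxev_pt -(h3 _ z) ?prim_expr_order //.
  rewrite mxev_pihomog_scale /mxev raddf_sum; apply: eq_bigr => i _ /=.
  by rewrite mevalZ.
have : pihomog mdeg d F = z ^+ d *: pihomog mdeg d F.
  have := congr1 (pihomog mdeg d) e; rewrite linear_sum (bigD1 d) //=.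
  rewrite linearZ /= pihomog_id big1 ?addr0 // => i id.
  by rewrite linearZ /= (pihomog_ne0 _ (pihomogP _ _ _)) ?scaler0.
move/eqP; rewrite -subr_eq0 -{1}[pihomog _ _ _]scale1r -scalerBl scaler_eq0.
case/orP => [|/eqP//]; rewrite subr_eq0 eq_sym -(prim_order_dvd zP).
by rewrite (negbTE nd).
Qed.

(** The representing polynomial is unique by density, so this choice is a ring morphism into a
    polynomial ring, and its kernel is zero. *)
Definition rep a := s2val (cid2 (total_repr a)).

Lemma rep_repr a : repr (rep a) (total a).
Proof. exact: s2valP (cid2 (total_repr a)). Qed.

Lemma rep_sym a : sym_poly (rep a).
Proof. exact: s2valP' (cid2 (total_repr a)). Qed.

Lemma rep_eq a F : repr F (total a) -> rep a = F.
Proof. exact: repr_uniq (rep_repr a). Qed.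

Lemma repD a b : rep (a + b) = rep a + rep b.
Proof.
apply: rep_eq; rewrite /total /= hornerD; apply: reprD; exact: rep_repr.
Qed.

Lemma repM a b : rep (a * b) = rep a * rep b.
Proof.
apply: rep_eq; rewrite /total /= hornerM; apply: reprM; exact: rep_repr.
Qed.

Lemma rep_0 : rep 0 = 0.
Proof. by apply: rep_eq; rewrite /total /= horner0; exact: repr0. Qed.

Lemma rep_1 : rep 1 = 1.
Proof. by apply: rep_eq; rewrite /total /= -polyC1 hornerC; exact: repr1. Qed.

Lemma repX a k : rep (a ^+ k) = rep a ^+ k.
Proof. by elim: k => [|k IH]; rewrite ?expr0 ?rep_1 // !exprS repM IH. Qed.

Lemma rep_inj a : rep a = 0 -> a = 0.
Proof. by move=> a0; apply: total_inj; rewrite -a0; exact: rep_repr. Qed.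

(** Transform F = G c by a symmetry of F and G and cancel G. *)
Lemma sym_poly_quotient F G c : G != 0 -> F = G * c ->
  sym_poly F -> sym_poly G -> sym_poly c.
Proof.
move=> G0 FE [F1 F2 F3] [G1 G2 G3].
have key (M : 'M_n) (h : 'M_q) :
    (forall A, mxev F (M *m A *m h) = mxev F A) ->
    (forall A, mxev G (M *m A *m h) = mxev G A) ->
    forall A, mxev c (M *m A *m h) = mxev c A.
  move=> hF hG A; have [c' c'E] := mxev_comp_mul c M h.
  rewrite -c'E; congr (mxev _ _); apply: (mulfI G0).
  rewrite -FE; apply: mpoly_eval_inj => v; rewrite mevalM !mxev_pt c'E -hG -hF FE.
  by rewrite /mxev mevalM.
split=> [A h dh|A t dt|A z z1].
- by rewrite -[A in LHS]mul1mx; apply: key => B; rewrite mul1mx; [exact: F1 | exact: G1].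
- by rewrite -[_ *m A]mulmx1; apply: key => B; rewrite mulmx1; [exact: F2 | exact: G2].
- rewrite -[z *: A]mulmx1 -mul_scalar_mx.
  by apply: key => B; rewrite mulmx1 mul_scalar_mx; [exact: F3 | exact: G3].
Qed.

Lemma git_integrally_closed : integrally_closed (git_ring X H n).
Proof.
split=> [a b ab0|K f finj frac z [p mp rz]].
  have /eqP : rep a * rep b = 0 by rewrite -repM ab0 rep_0.
  by rewrite mulf_eq0 => /orP[/eqP/rep_inj|/eqP/rep_inj]; [left | right].
have [a [b [b0 zE]]] := frac z.
have fb0 : f b != 0 by apply: contra b0 => /eqP; rewrite -(rmorph0 f) => /finj ->.
have [d sp] : exists d, size p = d.+1.
  by exists (size p).-1; rewrite prednK // lt0n size_poly_eq0 monic_neq0.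
have pd : p`_d = 1 by have := monicP mp; rewrite lead_coefE sp.
(* Multiplying the integral equation by [f b ^+ d] clears denominators; injectivity of f brings the
   relation back into the ring. *)
have rel : \sum_(i < d.+1) p`_i * a ^+ i * b ^+ (d - i) = 0.
  apply: finj; rewrite rmorph0 rmorph_sum.
  transitivity (f b ^+ d * (map_poly f p).[z]); last by rewrite (rootP rz) mulr0.
  rewrite (@horner_coef_wide _ d.+1) -?sp ?size_poly // mulr_sumr sp.
  apply: eq_bigr => i _; rewrite !rmorphM !rmorphXn coef_map /= zE exprMn exprVn.
  have -> : f b ^+ d = f b ^+ (d - i) * f b ^+ i by rewrite -exprD subnK // -ltnS.
  by field; rewrite expf_neq0.
have {}rel : rep a ^+ d + \sum_(i < d) rep p`_i * rep a ^+ i * rep b ^+ (d - i) = 0.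
  have := congr1 rep rel; rewrite (big_morph rep repD rep_0) rep_0 big_ord_recr /=.
  rewrite pd mul1r subnn expr0 mulr1 repX addrC => h; rewrite -[RHS]h; congr (_ + _).
  by apply: eq_bigr => i _; rewrite !repM !repX.
have rb0 : rep b != 0 by apply: contra b0 => /eqP/rep_inj ->.
(* Integrality gives divisibility along every line, so any point where [rep b] is nonzero serves as
   base and the genericity polynomial is 1. *)
have [A0 bA0] : exists v, (rep b).@[v] != 0.
  apply: contrapT => h; move/eqP: rb0; apply; apply: mpoly_eval0 => v.
  by apply/eqP/contraT => hv; case: h; exists v.
have [|B _|c cE] := @dvd_on_lines _ _ (rep a) (rep b) 1 A0 bA0.
- exact: oner_neq0.
- have lb0 : line0 (rep b) A0 B != 0.
    by apply: contraNneq bA0 => l0; rewrite -(line_coef0 _ A0 B) l0 coef0.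
  apply: (@dvdp_integral _ _ _ d (fun i => line0 (rep p`_i) A0 B)) => //.
  have := congr1 (fun F => line0 F A0 B) rel.
  rewrite /line0 /line rmorphD rmorph_sum rmorphXn rmorph0 /= => h; rewrite -[RHS]h; congr (_ + _).
  by apply: eq_bigr => i _; rewrite !rmorphM !rmorphXn.
have [c0 rc0] := sym_repr (sym_poly_quotient rb0 cE (rep_sym a) (rep_sym b)).
exists c0; rewrite zE; suff -> : a = b * c0 by rewrite rmorphM mulrAC mulfV ?mul1r.
apply/eqP; rewrite -subr_eq0; apply/eqP/rep_inj.
have repN (u : git_ring X H n) : rep (- u) = - rep u.
  by apply/eqP; rewrite -addr_eq0 -repD addNr rep_0.
by rewrite repD repN repM (rep_eq rc0) cE subrr.
Qed.

End IntegrallyClosed.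

(** * Maximal tori of SL_n *)

Definition diag_torus (C : numClosedFieldType) n (g : 'M[C]_n) : set 'M[C]_n :=
  [set h | exists2 t : 'rV_n, \prod_i t 0 i = 1 & h = g *m diag_mx t *m invmx g]%classic.

Section Torus.
Variables (C : numClosedFieldType) (m : nat).
Local Notation n := m.+1.
Local Open Scope classical_set_scope.

Definition conj_entry (g : 'M[C]_n) i j : {mpoly C[n * n]} :=
  \sum_k \sum_l (invmx g i k * g l j) *: 'X_(mxvec_index k l).

Lemma mxev_conj_entry g i j h :
  mxev (conj_entry g i j) h = (invmx g *m h *m g) i j.
Proof.
rewrite /mxev /conj_entry raddf_sum -mulmxA mxE; apply: eq_bigr => k _ /=.
rewrite raddf_sum mxE mulr_sumr; apply: eq_bigr => l _ /=.
by rewrite mevalZ mevalXU mxvecE; ring.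
Qed.

Definition torus_diag (t : 'I_m -> C) : 'rV[C]_n :=
  \row_i (if unlift ord_max i is Some j then t j else (\prod_l t l)^-1).

Lemma torus_diag_lift t j : torus_diag t 0 (lift ord_max j) = t j.
Proof. by rewrite mxE liftK. Qed.

Lemma torus_diag_max t : torus_diag t 0 ord_max = (\prod_l t l)^-1.
Proof. by rewrite mxE unlift_none. Qed.

Lemma prod_ord_max (R : comPzSemiRingType) (F : 'I_n -> R) :
  \prod_i F i = (\prod_j F (lift ord_max j)) * F ord_max.
Proof.
rewrite big_ord_recr; congr (_ * _); apply: eq_bigr => j _; congr F.
by apply/val_inj; rewrite /= /bump leqNgt ltn_ord.
Qed.

Lemma sum_ord_max (R : nmodType) (F : 'I_n -> R) :
  \sum_i F i = (\sum_j F (lift ord_max j)) + F ord_max.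
Proof.
rewrite big_ord_recr; congr (_ + _); apply: eq_bigr => j _; congr F.
by apply/val_inj; rewrite /= /bump leqNgt ltn_ord.
Qed.

Lemma Gm_prod_neq0 d (t : 'I_d -> C) : @Gm C d t -> \prod_l t l != 0.
Proof. by move=> tG; apply/prodf_neq0 => l _; exact: tG. Qed.

Lemma diag_torus_is_torus (g : 'M[C]_n) : g \in unitmx -> is_torus (diag_torus g).
Proof.
move=> ug; split.
- move=> h [t t1 ->]; rewrite /SL /= !det_mulmx det_inv det_diag t1 mulr1.
  by rewrite mulfV // -unitfE -unitmxE.
- exists [set p | (exists i j, i != j /\ p = conj_entry g i j) \/
    p = \det (\matrix_(i, j) 'X_(mxvec_index i j)) - 1].
  have detE h : mxev (\det (\matrix_(i, j) 'X_(mxvec_index i j)) - 1) h = \det h - 1.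
    rewrite /mxev mevalB meval1 -det_map_mx; congr (\det _ - 1).
    by apply/matrixP => i j; rewrite !mxE /= mevalXU mxvecE.
  apply/seteqP; split=> [h [t t1 ->] p [[i [j [ij ->]]]|->]|h /= hP].
  + rewrite -/(mxev _ _) mxev_conj_entry !mulmxA mulVmx // mul1mx mulmxKV //.
    by rewrite mxE (negbTE ij).
  + rewrite -/(mxev _ _) detE !det_mulmx det_inv det_diag t1 mulr1 mulfV ?subrr //.
    by rewrite -unitfE -unitmxE.
  pose t := \row_i (invmx g *m h *m g) i i.
  have hE : h = g *m diag_mx t *m invmx g.
    have -> : diag_mx t = invmx g *m h *m g.
      apply/matrixP => i j; rewrite [LHS]mxE; have [->|ij] := eqVneq i j.
        by rewrite [t 0 j]mxE.
      have := hP (conj_entry g i j); rewrite -/(mxev _ _) mxev_conj_entry => -> //.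
      by left; exists i, j.
    by rewrite !mulmxA mulmxV // mul1mx mulmxK.
  exists t => //; have := hP _ (or_intror erefl); rewrite -/(mxev _ _) detE => /eqP.
  rewrite subr_eq0 hE !det_mulmx det_inv det_diag mulrAC mulfV ?mul1r; first by move/eqP.
  by rewrite -unitfE -unitmxE.
exists m, (fun t => g *m diag_mx (torus_diag t) *m invmx g); split.
- apply/seteqP; split=> [h [t t1 ->]|h [t tG <-]].
    have t0 i : t 0 i != 0.
      by apply/eqP => ti; move/eqP: t1; rewrite (bigD1 i) //= ti mul0r eq_sym oner_eq0.
    exists (fun j => t 0 (lift ord_max j)) => [i|]; first exact: t0.
    congr (_ *m diag_mx _ *m _); apply/rowP => i.
    case: (unliftP ord_max i) => [j|] ->; first by rewrite torus_diag_lift.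
    rewrite torus_diag_max; move: t1; rewrite prod_ord_max => t1.
    have tp : \prod_j t 0 (lift ord_max j) != 0 by apply/prodf_neq0 => j _; exact: t0.
    by apply: (mulfI tp); rewrite t1 mulfV.
  exists (torus_diag t) => //; rewrite prod_ord_max torus_diag_max.
  under eq_bigr do rewrite torus_diag_lift.
  by rewrite mulfV // Gm_prod_neq0.
- move=> t u _ _; rewrite !mulmxA mulmxKV // -[_ *m diag_mx _ *m diag_mx _]mulmxA.
  congr (_ *m _ *m _); rewrite mulmx_diag; congr diag_mx; apply/rowP => i.
  rewrite mxE; case: (unliftP ord_max i) => [j|] ->; rewrite ?torus_diag_lift //.
    by rewrite [RHS]mxE !torus_diag_lift.
  by rewrite [RHS]mxE !torus_diag_max big_split invfM.
(* Only the last diagonal entry, the inverse of the product of the t's, has a denominator; the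
   exponent 1 clears it and leaves the constant term. *)
- move=> i j; exists ((\sum_k (g i (lift ord_max k) * invmx g (lift ord_max k) j) *: 'X_k)
    * \prod_l 'X_l + (g i ord_max * invmx g ord_max j)%:MP), 1%N => t /set_mem tG.
  have tp := Gm_prod_neq0 tG.
  rewrite expr1; apply: (mulIf tp); rewrite mulfVK // mevalD mevalM mevalC rmorph_prod /=.
  under [X in _ * X + _]eq_bigr do rewrite mevalXU.
  rewrite mul_mx_diag mxE (eq_bigr (fun k => g i k * torus_diag t 0 k * invmx g k j)); last first.
    by move=> k _; rewrite mxE.
  rewrite sum_ord_max mulrDl torus_diag_max; congr (_ + _); last first.
    by rewrite mulrAC mulfVK.
  congr (_ * _); rewrite raddf_sum; apply: eq_bigr => k _ /=.
  by rewrite mevalZ mevalXU torus_diag_lift; ring.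
- move=> l; exists (conj_entry g (lift ord_max l) (lift ord_max l)) => t _.
  rewrite -/(mxev _ _) mxev_conj_entry !mulmxA mulVmx // mul1mx mulmxKV //.
  by rewrite mxE eqxx torus_diag_lift.
Qed.

(* The matrices phi t with t of finite order are simultaneously diagonalizable,
   and roots of unity of large order detect polynomials of bounded degree. *)
Lemma torus_sub_diag (H : set 'M[C]_n) :
  is_torus H -> exists2 g, g \in unitmx & H `<=` diag_torus g.
Proof.
move=> [HSL _ [d [phi [HE phiM phi_rat _]]]].
have HG t : @Gm C d t -> H (phi t) by move=> tG; rewrite HE; exists t.
have detphi t : @Gm C d t -> \det (phi t) = 1 by move/HG/HSL.
have {}phiM t u : @Gm C d t -> @Gm C d u -> phi (fun l => t l * u l) = phi t *m phi u.
  by move=> tG uG; apply: phiM; exact/mem_set.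
have Gm1 : @Gm C d (fun=> 1) by move=> l; exact: oner_neq0.
(* An invertible idempotent is the identity. *)
have phi1 : phi (fun=> 1) = 1%:M.
  have u1 : phi (fun=> 1) \in unitmx by rewrite unitmxE detphi ?unitr1.
  have pp : phi (fun=> 1) *m phi (fun=> 1) = phi (fun=> 1).
    by rewrite -phiM //; congr phi; apply/funext => l; rewrite mulr1.
  by rewrite -[LHS](mulmxK u1) pp mulmxV.
pose e i j := cid (phi_rat i j).
pose p i j := projT1 (e i j); pose k i j := projT1 (cid (projT2 (e i j))).
have phiE t i j : @Gm C d t -> phi t i j = (p i j).@[t] / (\prod_l t l) ^+ k i j.
  by move=> tG; apply: (projT2 (cid (projT2 (e i j)))); exact/mem_set.
pose K := (\sum_i \sum_j k i j)%N.
have kK i j : (k i j <= K)%N.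
  by rewrite /K (bigD1 i) //= (bigD1 j) //= -!addnA leq_addr.
pose R i j : {mpoly C[d]} := p i j * (\prod_l 'X_l) ^+ (K - k i j).
have RE t i j : @Gm C d t -> (R i j).@[t] = phi t i j * (\prod_l t l) ^+ K.
  move=> tG; rewrite phiE // /R mevalM rmorphXn rmorph_prod /=.
  under eq_bigr do rewrite mevalXU.
  rewrite -{2}(subnK (kK i j)) exprD; have := Gm_prod_neq0 tG => tp.
  by rewrite [X in _ = _ * X]mulrC mulrA mulfVK ?expf_neq0.
(* N exceeds all exponents in the numerators R, so points whose coordinates are N-th roots of unity
   detect them. *)
pose N := (\sum_i \sum_j msize (R i j)).+1.
have RN i j : (msize (R i j) < N)%N.
  by rewrite /N ltnS (bigD1 i) //= (bigD1 j) //= -!addnA leq_addr.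
have [z zP] := prim_root_closed C (ltn0Sn (\sum_i \sum_j msize (R i j))).
have z0 : z != 0.
  apply/eqP => z0; have /eqP := prim_expr_order zP.
  by rewrite z0 expr0n eq_sym oner_eq0.
pose tz (u : {ffun 'I_d -> 'I_N}) l := z ^+ u l.
have tzG u : @Gm C d (tz u) by move=> l; exact: expf_neq0.
have phiX t j : @Gm C d t -> phi (fun l => t l ^+ j) = phi t ^+ j.
  move=> tG; elim: j => [|j IH].
    by rewrite expr0 -[RHS]/(1%:M) -phi1; congr phi; apply/funext => l; rewrite expr0.
  rewrite exprS -IH -[RHS]/(_ *m _) -phiM //; last by move=> l; rewrite expf_neq0 ?tG.
  by congr phi; apply/funext => l; rewrite exprS.
pose As := [seq phi (tz u) | u <- enum {: {ffun 'I_d -> 'I_N}}].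
have [|P uP /allP PA] := (codiagonalizableP As).1.
  split=> [A B /mapP[u _ ->] /mapP[v _ ->]|A /mapP[u _ ->]].
    by rewrite /comm_mx -!phiM //; congr phi; apply/funext => l; rewrite mulrC.
  (* The N-th power of [phi (tz u)] is the identity, so its minimal polynomial divides X^N - 1,
     which splits with distinct roots. *)
  apply/diagonalizableP; exists [seq z ^+ (i : 'I_N) | i <- enum 'I_N].
    rewrite map_inj_uniq ?enum_uniq // => i j /eqP.
    rewrite (eq_prim_root_expr zP) => /eqP; rewrite !modn_small // => ij.
    exact: val_inj.
  apply: mxminpoly_min.
  have -> : \prod_(x <- [seq z ^+ (i : 'I_N) | i <- enum 'I_N]) ('X - x%:P) = 'X^N - 1.
    by rewrite big_map -(factor_Xn_sub_1 zP) big_mkord big_enum.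
  rewrite rmorphB rmorphXn rmorph1 /= horner_mx_X -phiX //.
  rewrite (_ : (fun l => tz u l ^+ N) = fun=> 1); first by rewrite phi1 subrr.
  by apply/funext => l; rewrite /tz exprAC (prim_expr_order zP) expr1n.
have offdiag t a b : @Gm C d t -> a != b -> (P *m phi t *m invmx P) a b = 0.
  move=> tG ab.
  (* The numerator of an off-diagonal entry in the common eigenbasis: zero on the grid, hence
     zero. *)
  pose Q : {mpoly C[d]} := \sum_i \sum_j (P a i * invmx P j b) *: R i j.
  have QE u : @Gm C d u -> Q.@[u] = (P *m phi u *m invmx P) a b * (\prod_l u l) ^+ K.
    move=> uG; rewrite -mulmxA mxE mulr_suml /Q raddf_sum; apply: eq_bigr => i _ /=.
    rewrite raddf_sum mxE mulr_sumr mulr_suml; apply: eq_bigr => j _ /=.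
    by rewrite mevalZ RE // [LHS]mulrA [X in X * _ = _]mulrAC; congr (_ * _ ^+ _); rewrite mulrA.
  have Q0 : Q = 0.
    apply: (@mpoly_grid_eq0 _ _ _ [seq z ^+ (i : 'I_N) | i <- enum 'I_N]).
    - rewrite map_inj_uniq ?enum_uniq // => i j /eqP.
      rewrite (eq_prim_root_expr zP) => /eqP; rewrite !modn_small // => ij.
      exact: val_inj.
    - move=> w l; rewrite size_map size_enum_ord mcoeff_msupp => Qw.
      have [i [j Rw]] : exists i j, (R i j)@_w != 0.
        apply: contrapT => h; move/eqP: Qw; apply.
        rewrite raddf_sum big1 // => i _; rewrite /= raddf_sum big1 // => j _.
        rewrite /= mcoeffZ; have [->|nz] := eqVneq ((R i j)@_w) 0; first by rewrite mulr0.
        by case: h; exists i, j.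
      by apply: leq_trans (RN i j); rewrite ltnS ltnW // mnm_lt_msize // mcoeff_msupp.
    - move=> v hv.
      have [u ->] : exists u, v = tz u.
        exists [ffun l => projT1 (cid2 (elimT mapP (hv l)))]; apply/funext => l.
        by rewrite /tz ffunE; case: cid2.
      have PAu : diagonalizable_for P (phi (tz u)).
        by apply: PA; apply: map_f; rewrite mem_enum.
      by rewrite QE // (elimT (diagonalizable_forP _ uP) PAu) ?mul0r.
  have /eqP := QE t tG; rewrite Q0 meval0 eq_sym mulf_eq0 expf_eq0.
  by rewrite (negbTE (Gm_prod_neq0 tG)) andbF orbF => /eqP.
exists (invmx P); first by rewrite unitmx_inv.
move=> h; rewrite HE => -[t tG <-].
pose s := \row_i (P *m phi t *m invmx P) i i.
have sE : diag_mx s = P *m phi t *m invmx P.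
  apply/matrixP => i j; rewrite [LHS]mxE; have [->|ij] := eqVneq i j.
    by rewrite [s 0 j]mxE.
  by rewrite offdiag.
exists s; last by rewrite invmxK sE !mulmxA mulVmx // mul1mx mulmxKV.
rewrite -det_diag sE !det_mulmx det_inv detphi // mulr1 mulfV //.
by rewrite -unitfE -unitmxE.
Qed.

End Torus.

(** T lies in a conjugate of the diagonal torus, which is itself a torus, so maximality forces
    equality. *)
Lemma maximal_torus_diag (C : numClosedFieldType) n (T : set 'M[C]_n) :
  (0 < n)%N -> maximal_torus T -> exists2 g, g \in unitmx & T = diag_torus g.
Proof.
case: n T => // m T _ [Tt Tmax]; have [g ug Tg] := torus_sub_diag Tt.
by exists g => //; rewrite (Tmax _ (diag_torus_is_torus ug) Tg).
Qed.

(** * Parametrizations of the Grassmannian cone *)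

Lemma mxev_det (R : comNzRingType) m n k (E : 'M[{mpoly R[m * n]}]_k) A :
  mxev (\det E) A = \det (map_mx (fun p => mxev p A) E).
Proof. by rewrite /mxev -det_map_mx. Qed.

Section Wedge.
Variables (C : numClosedFieldType) (n r : nat).
Local Notation N := #|{: incr_seq n r}|.
Implicit Types (A : 'M[C]_(n, r)) (g : 'M[C]_n).

Lemma rowsub_mulmx (p k : nat) (f : 'I_p -> 'I_n) (M : 'M[C]_(n, k)) (l : nat) (B : 'M_(k, l)) :
  rowsub f (M *m B) = rowsub f M *m B.
Proof. by apply/matrixP => i j; rewrite !mxE; apply: eq_bigr => ? _; rewrite mxE. Qed.

Lemma det_wedge (Z : 'M[C]_(r, n)) A :
  \det (Z *m A) = ((\row_k \det (colsub (incr k) Z)) *m wedge A) 0 0.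
Proof.
by rewrite cauchy_binet mxE; apply: eq_bigr => k _; rewrite !mxE mulrC.
Qed.

Lemma ext_mx_wedge g A : ext_mx r g *m wedge A = wedge (g *m A).
Proof.
apply/colP => k; rewrite !mxE rowsub_mulmx cauchy_binet; apply: eq_bigr => l _.
rewrite !mxE mulrC; congr (_ * \det _).
by apply/matrixP => i j; rewrite !mxE.
Qed.

Lemma wedge_mulr A h : wedge (A *m h) = \det h *: wedge A.
Proof. by apply/colP => k; rewrite !mxE rowsub_mulmx det_mulmx mulrC. Qed.

(** A full-rank matrix has a left inverse Z, and 1 = det (Z A) is a linear combination of the minors
    of A. *)
Lemma wedge_neq0 A : (wedge A != 0) = (\rank A == r).
Proof.
apply/idP/idP => [|rA].
  apply: contraR => rA; apply/eqP/colP => k; rewrite !mxE.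
  apply/eqP; apply: contraR rA => d; apply/full_col_rankP => v Av.
  have u : rowsub (incr k) A \in unitmx by rewrite unitmxE unitfE.
  have u0 : rowsub (incr k) A *m v = 0.
    by rewrite -rowsub_mulmx Av; apply/matrixP => i j; rewrite !mxE.
  by rewrite -[v](mulKmx u) u0 mulmx0.
have [Z ZA] : exists Z : 'M[C]_(r, n), Z *m A = 1%:M.
  exists (pinvmx A^T)^T; apply: trmx_inj; rewrite trmx_mul trmxK trmx1.
  by rewrite mulmxVp // /row_free mxrank_tr.
apply/eqP => w0; have := det_wedge Z A.
by rewrite ZA det1 w0 mulmx0 mxE => /eqP; rewrite oner_eq0.
Qed.

Lemma wedge_poly g k : exists p, forall A, wedge (g *m A) k 0 = mxev p A.
Proof.
exists (\det (\matrix_(i < r, j < r) \sum_l g (incr k i) l *: 'X_(mxvec_index l j))) => A.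
rewrite mxev_det mxE; congr (\det _); apply/matrixP => i j; rewrite !mxE /mxev raddf_sum.
by apply: eq_bigr => l _ /=; rewrite mevalZ mevalXU mxvecE.
Qed.

Lemma wedge_param (le_rn : (r <= n)%N) g : g \in unitmx ->
  minors_param (Grassmannian C le_rn) (fun A : 'M_(n, r) => wedge (g *m A)).
Proof.
move=> ug; split.
- exact: wedge_poly.
- move=> Z; exists (\row_k \det (colsub (incr k) (Z *m invmx g))) => A.
  by rewrite -det_wedge !mulmxA mulmxKV.
- by move=> A h; rewrite mulmxA wedge_mulr.
- move=> v; split=> [[v0 [A vA]]|[A [rA ->]]].
    exists (invmx g *m A); rewrite mulKVmx // mxrank_unitl ?unitmx_inv //; split=> //.
    by apply/eqP; rewrite -wedge_neq0 -vA.
  by split; [rewrite wedge_neq0 mxrank_unitl // rA | exists (g *m A)].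
Qed.

End Wedge.

Lemma wedge_action (C : numClosedFieldType) n r (g : 'M[C]_n) : g \in unitmx ->
  param_action (fun A : 'M_(n, r) => wedge (g *m A)) (ext_mx r @` diag_torus g)%classic.
Proof.
move=> ug; have E (t : 'rV_n) A :
    ext_mx r (g *m diag_mx t *m invmx g) *m wedge (g *m A) = wedge (g *m (diag_mx t *m A)).
  by rewrite ext_mx_wedge !mulmxA mulmxKV.
split=> [t t1|_ [h [t t1 ->] <-]]; last by exists t.
exists (ext_mx r (g *m diag_mx t *m invmx g)) => //.
by exists (g *m diag_mx t *m invmx g) => //; exists t.
Qed.

Lemma complement_rows (F : fieldType) a b n (Z : 'M[F]_(a, n)) :
  (a + b)%N = n -> \rank Z = a -> exists W : 'M_(b, n), row_full (Z + W)%MS.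
Proof.
move=> abn rZ; have e : \rank Z^C%MS = b by rewrite mxrank_compl rZ -abn addKn.
exists (castmx (e, erefl) (row_base Z^C%MS)).
have E := eqmx_trans (eqmx_cast (row_base Z^C%MS) (e, erefl)) (eq_row_base _).
by rewrite /row_full (adds_eqmx (eqmx_refl Z) E); exact: addsmx_compl_full.
Qed.

(** * The dual parametrization by complementary minors *)

Section Dual.
Variables (C : numClosedFieldType) (r q : nat) (r_gt0 : (0 < r)%N) (q_gt0 : (0 < q)%N).
Local Notation n := (r + q)%N.
Local Notation N := #|{: incr_seq n r}|.
Implicit Types (A : 'M[C]_(n, r)) (B : 'M[C]_(n, q)) (g : 'M[C]_n).

Definition coord_cols (f : 'I_r -> 'I_n) : 'M[C]_(n, r) := \matrix_(i, j) (i == f j)%:R.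

(* The Hodge dual of [wedge B], in the coordinates of wedge^r C^n. *)
Definition cowedge B : 'cV[C]_N := \col_k \det (row_mx (coord_cols (incr k)) B).

Lemma mul_coord_cols m (M : 'M[C]_(m, n)) f : M *m coord_cols f = colsub f M.
Proof.
apply/matrixP => i j; rewrite !mxE.
under eq_bigr do rewrite mxE mulrC.
by rewrite sum_delta.
Qed.

(** Laplace expansion along the first r columns, obtained by expanding the columns of A in the
    standard basis. *)
Lemma det_row_mx_cowedge A B :
  \det (row_mx A B) = ((\row_k \det (rowsub (incr k) A)) *m cowedge B) 0 0.
Proof.
transitivity (\sum_(f : {ffun 'I_r -> 'I_n})
    (\prod_i A (f i) i) * \det (row_mx (coord_cols f) B)).
  rewrite -[LHS]det_tr [LHS]/determinant.
  under eq_bigr => s _.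
    rewrite big_split_ord /=.
    under eq_bigr => i _ do rewrite mxE row_mxEl -(sum_delta (s (lshift q i)) (fun k => A k i)).
    rewrite bigA_distr_bigA mulrA mulr_sumr mulr_suml /=.
    over.
  rewrite exchange_big /=; apply: eq_bigr => f _.
  rewrite -det_tr /determinant mulr_sumr; apply: eq_bigr => s _.
  rewrite [in RHS]big_split_ord /= big_split /=.
  rewrite [X in _ = _ * (_ * (X * _))](eq_bigr (fun i => (f i == s (lshift q i))%:R)).
    rewrite [X in _ = _ * (_ * (_ * X))](eq_bigr (fun i =>
      (row_mx A B)^T (rshift r i) (s (rshift r i)))).
      by rewrite -!mulrA [RHS]mulrCA; congr (_ * _); rewrite mulrCA.
    by move=> i _; rewrite [LHS]mxE [RHS]mxE !row_mxEr.
  by move=> i _; rewrite mxE row_mxEl mxE eq_sym.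
rewrite (alternating_minors (u := fun f => \det (row_mx (coord_cols f) B))).
- rewrite mxE; apply: eq_bigr => k _; rewrite !mxE; congr (_ * \det (row_mx _ _)).
  by apply/matrixP => i j; rewrite !mxE ffunE.
- move=> f ninj; have /existsP[i /existsP[j /andP[ij /eqP fij]]] :
      [exists i, exists j, (i != j) && (f i == f j)].
    apply/contraT => /existsPn h; case: ninj => i j e; apply/eqP/contraT => ij.
    by have := h i => /existsPn/(_ j); rewrite ij e eqxx.
  rewrite -det_tr (@determinant_alternate _ _ _ (lshift q i) (lshift q j))
    ?(inj_eq (@lshift_inj _ _)) //.
  by move=> k; rewrite [LHS]mxE [RHS]mxE !row_mxEl !mxE fij.
- move=> f s.
  have -> : row_mx (coord_cols [ffun i => f (s i)]) B =
      row_mx (coord_cols f) B *m block_mx (perm_mx s^-1) 0 0 1%:M.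
    rewrite mul_row_block !mulmx0 addr0 add0r mulmx1; congr row_mx.
    by rewrite -col_permE; apply/matrixP => i j; rewrite !mxE ffunE.
  by rewrite det_mulmx det_ublock det_perm det1 mulr1 odd_permV mulrC.
Qed.

Lemma cowedge_mulr B h : cowedge (B *m h) = \det h *: cowedge B.
Proof.
apply/colP => k; rewrite !mxE.
have -> : row_mx (coord_cols (incr k)) (B *m h) =
    row_mx (coord_cols (incr k)) B *m block_mx 1%:M 0 0 h.
  by rewrite mul_row_block !mulmx0 addr0 add0r mulmx1.
by rewrite det_mulmx det_ublock det1 mul1r mulrC.
Qed.

(* If B is the right block of g^-T, then g^T *m [E_I | B] is block triangular
   with diagonal blocks (lsubmx g)_I^T and 1. *)
Lemma wedge_cowedge g : g \in unitmx ->
  wedge (lsubmx g) = \det g *: cowedge (rsubmx (invmx g)^T).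
Proof.
move=> ug; apply/colP => k; rewrite !mxE; set B := rsubmx _.
rewrite -[\det g]det_tr -det_mulmx.
have gB : g^T *m (invmx g)^T = 1%:M by rewrite -trmx_mul mulVmx // trmx1.
have {gB} [lB rB] : (lsubmx g)^T *m B = 0 /\ (rsubmx g)^T *m B = 1%:M.
  move: gB; rewrite -{1}[g]hsubmxK tr_row_mx -[(invmx g)^T]hsubmxK mul_col_row.
  by rewrite scalar_mx_block => /eq_block_mx[_ -> _ ->].
rewrite -[g in g^T]hsubmxK tr_row_mx mul_col_row lB rB det_lblock det1 mulr1.
rewrite mul_coord_cols -[RHS]det_tr; congr (\det _).
by apply/matrixP => i j; rewrite !mxE.
Qed.

(** Complete Z by W to an invertible S and choose Y with S Y = (1; 0). Then S [Y | B] is block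
    triangular with diagonal blocks 1 and Z B, and Laplace expansion of det [Y | B] applies. If Z is
    rank-deficient both sides vanish. *)
Lemma cowedge_minor (Z : 'M[C]_(q, n)) : exists u : 'rV_N,
  forall B, \det (Z *m B) = (u *m cowedge B) 0 0.
Proof.
have [rZ|rZ] := eqVneq (\rank Z) q; last first.
  exists 0 => B; rewrite mul0mx mxE; apply/eqP; apply: contraR rZ => d.
  rewrite eqn_leq rank_leq_row /=.
  have : Z *m B \in unitmx by rewrite unitmxE unitfE.
  by rewrite -row_free_unit => /eqP e; rewrite -{1}e mxrankM_maxl.
have [W fW] := complement_rows (addnC q r) rZ.
have uS : col_mx W Z \in unitmx by rewrite -row_full_unit /row_full -addsmxE addsmxC.
pose S := col_mx W Z; pose Y := invmx S *m col_mx 1%:M 0 : 'M_(n, r).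
exists ((\det S) *: \row_k \det (rowsub (incr k) Y)) => B.
rewrite -scalemxAl mxE -det_row_mx_cowedge -det_mulmx mul_mx_row mulKVmx //.
by rewrite /S mul_col_mx -block_mxEh det_ublock det1 mul1r.
Qed.

Lemma dual_frame B : \rank B = q ->
  exists2 g, g \in unitmx & rsubmx (invmx g)^T = B.
Proof.
move=> rB; have rBt : \rank B^T = q by rewrite mxrank_tr.
have [W fW] := complement_rows (addnC q r) rBt.
have uM : col_mx W B^T \in unitmx by rewrite -row_full_unit /row_full -addsmxE addsmxC.
exists (invmx (col_mx W B^T)); first by rewrite unitmx_inv.
by rewrite invmxK tr_col_mx row_mxKr trmxK.
Qed.

Lemma primal_frame A : \rank A = r -> exists2 g, g \in unitmx & lsubmx g = A.
Proof.
move=> rA; have rAt : \rank A^T = r by rewrite mxrank_tr.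
have [W fW] := complement_rows erefl rAt.
have uM : col_mx A^T W \in unitmx by rewrite -row_full_unit /row_full -addsmxE.
exists (col_mx A^T W)^T; first by rewrite unitmx_tr.
by rewrite tr_col_mx row_mxKl trmxK.
Qed.

Lemma rank_lsubmx g : g \in unitmx -> \rank (lsubmx g) = r.
Proof.
move=> ug; apply/eqP/full_col_rankP => v gv.
have : g *m col_mx v 0 = 0 by rewrite -[g]hsubmxK mul_row_col gv mulmx0 addr0.
move/(congr1 (mulmx (invmx g))); rewrite mulKmx // mulmx0 -[0 in RHS]col_mx0.
by case/eq_col_mx.
Qed.

Lemma rank_rsubmx g : g \in unitmx -> \rank (rsubmx g) = q.
Proof.
move=> ug; apply/eqP/full_col_rankP => v gv.
have : g *m col_mx 0 v = 0 by rewrite -[g]hsubmxK mul_row_col gv mulmx0 addr0.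
move/(congr1 (mulmx (invmx g))); rewrite mulKmx // mulmx0 -[0 in RHS]col_mx0.
by case/eq_col_mx.
Qed.

Lemma cowedge_poly g k : exists p, forall B, cowedge (g *m B) k 0 = mxev p B.
Proof.
pose E : 'M[{mpoly C[n * q]}]_n := row_mx (map_mx (@mpolyC _ _) (coord_cols (incr k)))
  (\matrix_(i, j) \sum_l g i l *: 'X_(mxvec_index l j)).
exists (\det E) => B; rewrite mxev_det mxE; congr (\det _).
rewrite map_row_mx; congr row_mx; apply/matrixP => i j; rewrite !mxE.
  by rewrite /mxev mevalC.
rewrite /mxev raddf_sum; apply: eq_bigr => l _ /=.
by rewrite mevalZ mevalXU mxvecE.
Qed.

Lemma det_root k (d : C) : (0 < k)%N -> \det ((k.-root d)%:M : 'M_k) = d.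
Proof. by move=> k0; rewrite det_scalar rootCK. Qed.

(** A frame extending A, or extending g B dually, exchanges wedges and cowedges up to a determinant;
    a scalar matrix built from a q-th or r-th root absorbs that factor. *)
Lemma cowedge_param (le_rn : (r <= n)%N) g : g \in unitmx ->
  minors_param (Grassmannian C le_rn) (fun B : 'M_(n, q) => cowedge (g *m B)).
Proof.
move=> ug; split.
- exact: cowedge_poly.
- move=> Z; have [u uE] := cowedge_minor (Z *m invmx g).
  by exists u => B; rewrite -uE !mulmxA mulmxKV.
- by move=> A h; rewrite mulmxA cowedge_mulr.
- move=> v; split=> [[v0 [A vA]]|[B [rB ->]]].
    have [|h uh hA] := @primal_frame A; first by apply/eqP; rewrite -wedge_neq0 -vA.
    pose B := rsubmx (invmx h)^T *m (q.-root (\det h))%:M.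
    exists (invmx g *m B); rewrite mulKVmx // mxrank_unitl ?unitmx_inv //.
    rewrite mxrankMfree; last first.
      rewrite row_free_unit unitmxE det_root // -unitmxE //.
    rewrite rank_rsubmx ?unitmx_tr ?unitmx_inv //; split=> //.
    by rewrite /B cowedge_mulr det_root // -wedge_cowedge // hA.
  have [|h uh hB] := @dual_frame (g *m B); first by rewrite mxrank_unitl.
  have vE : cowedge (g *m B) = wedge (lsubmx h *m (r.-root (\det h)^-1)%:M).
    rewrite wedge_mulr det_root // wedge_cowedge // hB scalerA mulVf ?scale1r //.
    by rewrite -unitfE -unitmxE.
  rewrite vE; split; last by exists (lsubmx h *m (r.-root (\det h)^-1)%:M).
  rewrite wedge_neq0 mxrankMfree ?rank_lsubmx //.
  by rewrite row_free_unit unitmxE det_root // unitrV -unitmxE.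
Qed.

(** For determinant 1, the r-th exterior power is dual to the q-th, so h acts on B by its inverse
    transpose. *)
Lemma ext_mx_cowedge h B : \det h = 1 -> \rank B = q ->
  ext_mx r h *m cowedge B = cowedge ((invmx h)^T *m B).
Proof.
move=> h1 /dual_frame[g ug <-].
have uh : h \in unitmx by rewrite unitmxE h1 unitr1.
have g0 : \det g != 0 by rewrite -unitfE -unitmxE.
apply: (scalerI g0); rewrite scalemxAr -wedge_cowedge // ext_mx_wedge.
have -> : h *m lsubmx g = lsubmx (h *m g) by rewrite -[g]hsubmxK mul_mx_row !row_mxKl.
have uhg : h *m g \in unitmx by rewrite unitmx_mul uh.
rewrite wedge_cowedge // det_mulmx h1 mul1r; congr (_ *: cowedge _).
have -> : invmx (h *m g) = invmx g *m invmx h.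
  by rewrite -[RHS](mulKmx uhg) (mulmxA (h *m g)) mulmxK // mulmxV // mulmx1.
by rewrite trmx_mul -[(invmx g)^T]hsubmxK mul_mx_row !row_mxKr.
Qed.

(** In the dual frame the element g t g^-1 acts as t^-1, and inversion preserves the diagonal
    torus. *)
Lemma cowedge_action g : g \in unitmx ->
  param_action (fun B => cowedge ((invmx g)^T *m B)) (ext_mx r @` diag_torus g)%classic.
Proof.
move=> ug; pose inv (t : 'rV[C]_n) := map_mx GRing.inv t.
have prod_inv (t : 'rV[C]_n) : \prod_i t 0 i = 1 -> \prod_i (inv t) 0 i = 1.
  by move=> t1; under eq_bigr do rewrite mxE; rewrite prodfV t1 invr1.
have invK (t : 'rV[C]_n) : inv (inv t) = t by apply/rowP => i; rewrite !mxE invrK.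
have E (t : 'rV[C]_n) B : \prod_i t 0 i = 1 -> \rank B = q ->
    ext_mx r (g *m diag_mx t *m invmx g) *m cowedge ((invmx g)^T *m B) =
    cowedge ((invmx g)^T *m (diag_mx (inv t) *m B)).
  move=> t1 rB; set h := _ *m invmx g.
  have h1 : \det h = 1.
    rewrite !det_mulmx det_inv det_diag t1 mulr1 mulfV //.
    by rewrite -unitfE -unitmxE.
  have uh : h \in unitmx by rewrite unitmxE h1 unitr1.
  rewrite ext_mx_cowedge // ?mxrank_unitl ?unitmx_tr ?unitmx_inv // !mulmxA.
  congr (cowedge (_ *m B)).
  have hh : (invmx h)^T *m h^T = 1%:M by rewrite -trmx_mul mulmxV // trmx1.
  have gg : g^T *m (invmx g)^T = 1%:M by rewrite -trmx_mul mulVmx // trmx1.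
  have tt : diag_mx t *m diag_mx (inv t) = 1%:M.
    rewrite mulmx_diag -diag_const_mx; congr diag_mx; apply/rowP => i.
    rewrite !mxE mulfV //; apply/eqP => ti.
    by move/eqP: t1; rewrite (bigD1 i) //= ti mul0r eq_sym oner_eq0.
  rewrite -[RHS]mul1mx -hh -mulmxA; congr (_ *m _).
  rewrite /h !trmx_mul tr_diag_mx -!mulmxA (mulmxA g^T) gg mul1mx tt mulmx1 //.
split=> [t t1|_ [h [t t1 ->] <-]]; last by exists (inv t) => [|B rB]; [exact: prod_inv|exact: E].
exists (ext_mx r (g *m diag_mx (inv t) *m invmx g)).
  exists (g *m diag_mx (inv t) *m invmx g) => //; exists (inv t) => //; exact: prod_inv.
by move=> B rB; rewrite E ?prod_inv // invK.
Qed.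

End Dual.

Lemma param_projectively_normal (C : numClosedFieldType) n q N (X : cone N)
    (psi : 'M[C]_(n, q) -> 'cV[C]_N) (H : set 'M[C]_N) :
  q = 1%N \/ q = 2%N -> (q < n)%N -> minors_param X psi -> param_action psi H ->
  git_projectively_normal X H n.
Proof.
move=> q12 q_lt_n psiP actP.
have n_gt0 : (0 < n)%N by exact: leq_ltn_trans q_lt_n.
have q_gt0 : (0 < q)%N by case: q12 => ->.
have units k (F : {mpoly C[n * q]}) : inv_poly k F -> lincomb (unit_prod k) F.
  case: q12 F => e; move: psi psiP actP q_lt_n q_gt0; rewrite {}e => *.
    exact: inv_poly_units1.
  exact: inv_poly_units2.
split; first exact: (git_integrally_closed q_gt0 q_lt_n psiP actP units).
exact: (git_generated q_lt_n psiP actP units).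
Qed.

Local Open Scope classical_set_scope.

Theorem theorem6p1 (R : realType) (n r : nat) (T : set 'M[R[i]]_n)
    (r_gt0 : (0 < r)%N) (r_ltn : (r < n)%N) (T_max : maximal_torus T) :
  [\/ r = 1%N, r = 2%N, r = (n - 2)%N | r = (n - 1)%N] ->
  git_projectively_normal (Grassmannian R[i] (ltnW r_ltn)) (ext_mx r @` T) n.
Proof.
have [g ug ->] := maximal_torus_diag (leq_ltn_trans (leq0n r) r_ltn) T_max.
move=> hr; have [r12|q12] : (r = 1%N \/ r = 2%N) \/ (n - r = 1%N \/ n - r = 2%N)%N.
- case: hr => e; [by left; left | by left; right | right; right | right; left].
    (* Natural subtraction truncates; r > 0 guarantees that it does not here. *)
    by rewrite e subKn //; move: r_gt0; rewrite e subn_gt0 => /ltnW.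
  by rewrite e subKn //; move: r_gt0; rewrite e subn_gt0 => /ltnW.
- exact: (param_projectively_normal r12 r_ltn (wedge_param (ltnW r_ltn) ug) (wedge_action r ug)).
have q_gt0 : (0 < n - r)%N by rewrite subn_gt0.
(* Matrices of size r + q are needed for the block decompositions of the dual parametrization. *)
have nE : n = (r + (n - r))%N by rewrite subnKC // ltnW.
move: (n - r)%N nE q12 q_gt0 => q nE q12 q_gt0.
subst n; have ugt : (invmx g)^T \in unitmx by rewrite unitmx_tr unitmx_inv.
apply: (param_projectively_normal q12 _ (cowedge_param r_gt0 q_gt0 (ltnW r_ltn) ugt)
  (cowedge_action ug)).
by rewrite -[X in (X < _)%N]add0n ltn_add2r.
Qed.
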